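(* Let $d\ge1$ be an integer, let $\Phi$ be a depth $d+1$ formula on variables $x_1,\dots,x_n$, and let $\ell>0$. Then, with $\sigma\in\{0,1\}^n$ and $\tau\in[0,1]^n$ independent and uniformly distributed, \[ \Pr\Big[\ \mathbf q^{\sigma,\tau}(\Phi)\le \frac{1}{14^{d+1}\ell}\ \Big]\le \|\Phi\|\,\frac{C^d}{\exp\big(\mathrm e^{-2}d\,\ell^{1/d}\big)}, \] where \[ C=1+\sum_{i=0}^\infty\Bigg(\frac{1}{\exp(\mathrm e^{i-1}-(i+1)\mathrm e^{-2})}+\sum_{j=0}^\infty\frac{1}{\exp((j+1)\mathrm e^{i-1}-(i+j+2)\mathrm e^{-2})}\Bigg)\approx 7.83. \] In particular, for every depth $d+1$ formula $\Phi$ and $0<\lambda\le 1$, $\Pr[\mathbf q^{\sigma,\tau}(\Phi)\le\lambda]\le \|\Phi\|/\exp\big(\Omega(d\lambda^{-1/d})-O(d)\big)$.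
   Context: A formula is a finite rooted tree whose leaves are labeled by literals ($x_i$ or $\neg x_i$) and whose internal nodes (gates) are labeled AND or OR, with unbounded fan-in; it computes a boolean function of $x_1,\dots,x_n$. Its size $\|\Phi\|$ is the number of gates; its depth is the maximum number of gates on a leaf-to-root path. A restriction is a map $\varrho:[n]\to\{0,1,\ast\}$; for a boolean function $f$, $f{\upharpoonright}\varrho$ is obtained by fixing $x_i=\varrho(i)$ whenever $\varrho(i)\ne\ast$. $\mathsf D(f)$ denotes decision-tree depth (minimum depth of a decision tree computing $f$; $\mathsf D(f)=0$ iff $f$ is constant). For $\sigma\in\{0,1\}^n$, $\tau\in[0,1]^n$, $p\in[0,1]$, the restriction $R^{\sigma,\tau}_p$ is defined by $R^{\sigma,\tau}_p(i)=\sigma_i$ if $\tau_i>p$ and $R^{\sigma,\tau}_p(i)=\ast$ if $\tau_i\le p$. For every formula $\Phi$, $\mathbf q^{\sigma,\tau}(\Phi)\in[0,1]$ is defined inductively: if $\Phi$ is a literal, $\mathbf q^{\sigma,\tau}(\Phi)=1$; if $\Phi=\mathrm{AND}(\Psi_1,\dots,\Psi_m)$ or $\mathrm{OR}(\Psi_1,\dots,\Psi_m)$, then $\mathbf q^{\sigma,\tau}(\Phi)=\mathbf p^{\sigma,\tau}(\Phi)/(14\,\mathbf k^{\sigma,\tau}(\Phi))$, where $\mathbf p^{\sigma,\tau}(\Phi)=\min_i \mathbf q^{\sigma,\tau}(\Psi_i)$ and $\mathbf k^{\sigma,\tau}(\Phi)=\max\{1,\max_i \mathsf D(\Psi_i{\upharpoonright}R^{\sigma,\tau}_{\mathbf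 p^{\sigma,\tau}(\Phi)})\}$. *)

(* Defs.v *)
From mathcomp Require Export all_boot all_order all_algebra.
From mathcomp Require Export all_classical all_reals all_analysis.
Export Order.TTheory GRing.Theory Num.Theory.
Export numFieldNormedType.Exports.

Set Implicit Arguments.
Unset Strict Implicit.
Unset Printing Implicit Defensive.

Local Open Scope classical_set_scope.
Local Open Scope ring_scope.

(* Gates take a first child and a list of further children, so that every leaf
   of the tree is a literal. [Lit i b] is x_i if b = true and ~ x_i otherwise. *)
Inductive gate := AND | OR.

Inductive formula (n : nat) : Type :=
| Lit of 'I_n & bool
| Gate of gate & formula n & seq (formula n).

Fixpoint size_formula n (Phi : formula n) : nat :=
  match Phi with
  | Lit _ _ => 0
  | Gate _ Psi Psis =>
      (size_formula Psi + sumn [seq size_formula Psi' | Psi' <- Psis]).+1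
  end.

Fixpoint depth_formula n (Phi : formula n) : nat :=
  match Phi with
  | Lit _ _ => 0
  | Gate _ Psi Psis =>
      (foldr maxn (depth_formula Psi)
        [seq depth_formula Psi' | Psi' <- Psis]).+1
  end.

Definition boolfun n := n.-tuple bool -> bool.

Fixpoint eval_formula n (Phi : formula n) : boolfun n := fun x =>
  match Phi with
  | Lit i b => tnth x i == b
  | Gate AND Psi Psis =>
      eval_formula Psi x && all (fun Psi' => eval_formula Psi' x) Psis
  | Gate OR Psi Psis =>
      eval_formula Psi x || has (fun Psi' => eval_formula Psi' x) Psis
  end.

(* [None] stands for the star. *)
Definition restriction n := 'I_n -> option bool.

Definition restrict n (f : boolfun n) (rho : restriction n) : boolfun n :=
  fun x => f [tuple odflt (tnth x i) (rho i) | i < n].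

(* [DNode i t0 t1] queries x_i and continues with t0 if x_i = 0, t1 if x_i = 1. *)
Inductive dtree (n : nat) : Type :=
| DLeaf of bool
| DNode of 'I_n & dtree n & dtree n.

Fixpoint depth_dtree n (t : dtree n) : nat :=
  match t with
  | DLeaf _ => 0
  | DNode _ t0 t1 => (maxn (depth_dtree t0) (depth_dtree t1)).+1
  end.

Fixpoint eval_dtree n (t : dtree n) : boolfun n := fun x =>
  match t with
  | DLeaf b => b
  | DNode i t0 t1 => if tnth x i then eval_dtree t1 x else eval_dtree t0 x
  end.

Definition has_dtree_depth n (f : boolfun n) (k : nat) : bool :=
  `[< exists2 t : dtree n, eval_dtree t =1 f & depth_dtree t = k >].

Fixpoint query_all n (f : boolfun n) (s : seq 'I_n) (x : n.-tuple bool)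
    : dtree n :=
  match s with
  | [::] => DLeaf n (f x)
  | i :: s' =>
      DNode i
        (query_all f s' [tuple if j == i then false else tnth x j | j < n])
        (query_all f s' [tuple if j == i then true else tnth x j | j < n])
  end.

Lemma eval_query_all n (f : boolfun n) s x y :
  (forall i, i \notin s -> tnth x i = tnth y i) ->
  eval_dtree (query_all f s x) y = f y.
Proof.
elim: s x => [|i s IH] x xy /=.
  by congr f; apply: eq_from_tnth => i; exact: xy.
case yi : (tnth y i); apply: IH => j js; rewrite tnth_mktuple;
  by case: eqVneq => [->|ji]; rewrite ?yi//; apply: xy; rewrite in_cons negb_or ji.
Qed.

Lemma ex_dtree_depth n (f : boolfun n) : exists k, has_dtree_depth f k.
Proof.
set t := query_all f (enum 'I_n) [tuple false | _ < n].
exists (depth_dtree t); apply/asboolP; exists t => // x.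
by apply: eval_query_all => i; rewrite mem_enum.
Qed.

Definition Ddepth n (f : boolfun n) : nat := ex_minn (ex_dtree_depth f).

Section qval.
Context (R : realType) (n : nat).
Implicit Types (sigma : n.-tuple bool) (tau : n.-tuple R).

Definition Rst sigma tau (p : R) : restriction n :=
  fun i => if p < tnth tau i then Some (tnth sigma i) else None.

Definition kval sigma tau (Psis : seq (formula n)) (p : R) : nat :=
  maxn 1 (\max_(Psi <- Psis)
            Ddepth (restrict (eval_formula Psi) (Rst sigma tau p))).

Fixpoint qval sigma tau (Phi : formula n) : R :=
  match Phi with
  | Lit _ _ => 1
  | Gate _ Psi Psis =>
      let p := foldr Num.min (qval sigma tau Psi)
                 [seq qval sigma tau Psi' | Psi' <- Psis] in
      p / (14 * (kval sigma tau (Psi :: Psis) p)%:R)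
  end.

End qval.

Section laws.
Context (disp disp1 disp2 : measure_display) (T : measurableType disp)
  (T1 : measurableType disp1) (T2 : measurableType disp2)
  (R : realType) (P : probability T R).
Local Open Scope ereal_scope.

Definition independent_RV2 (X : {RV P >-> T1}) (Y : {RV P >-> T2}) : Prop :=
  forall (A : set T1) (B : set T2), measurable A -> measurable B ->
    P (X @^-1` A `&` Y @^-1` B) = P (X @^-1` A) * P (Y @^-1` B).

Definition uniform_bits (n : nat) (sigma : {RV P >-> n.-tuple bool}) : Prop :=
  forall s : n.-tuple bool, P (sigma @^-1` [set s]) = ((2 ^+ n)^-1)%:E.

(* The law of tau is the n-fold product of the uniform law on [0, 1], which is
   determined by its values on boxes. *)
Definition uniform_cube (n : nat) (tau : {RV P >-> n.-tuple R}) : Prop :=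
  forall B : 'I_n -> set R, (forall i, measurable (B i)) ->
    P [set w | forall i, B i (tnth (tau w) i)] =
    \prod_(i < n) uniform_prob (@ltr01 R) (B i).

End laws.

Definition Cconst (R : realType) : R :=
  1 + limn (series (fun i : nat =>
    (expR (expR (i%:R - 1) - i.+1%:R * expR (- 2)))^-1 +
    limn (series (fun j : nat =>
      (expR (j.+1%:R * expR (i%:R - 1) - (i + j + 2)%N%:R * expR (- 2)))^-1)))).

(* Main.v *)
(** A switching lemma in Razborov's form, proved by induction on the terms of a
    DNF with a family of restrictions closed under fixing stars, gives
    [Pr[D(f | R) >= s] <= (a / e)^s] when [f] is an OR (or AND) of functions of
    decision-tree depth at most [k] and [R] has star probability [a / (14 k)].
    Since [q] only depends on the restrictions [R_p] with [p >= q], the times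
    [tau_i <= p(Phi)] can be resampled, so the bound still holds for the random
    [k(Phi)], conditionally on [q(Phi)].

    For the tail of [q], write [l = lam^d] and [u = 14^d p(Phi) lam^(d-1)].  The
    event forces [u lam <= k(Phi)].  Either a child has [q] smaller by a factor
    [e] than its share, or [e^(i-1) <= u < e^i] and some child [Psi] has depth at
    least [lam e^(i-1)] at the restriction [R_p], where [p <= e^-j q(Psi)] and
    [14^d q(Psi) lam^(d-1)] is about [e^(i+j)].  Only the child [Psi] is involved,
    so a union bound over children, [i] and [j] costs the factor [C]. *)

From HB Require Import structures.
Require Import Defs.
From mathcomp Require Import ring lra zify.

Set Implicit Arguments.
Unset Strict Implicit.
Unset Printing Implicit Defensive.

Local Open Scope classical_set_scope.
Local Open Scope ring_scope.

(** * Decision-tree depth *)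

Section decision_tree_depth.
Context (n : nat).
Implicit Types (f g : boolfun n) (r : restriction n) (t : dtree n).

Lemma Ddepth_le f t : eval_dtree t =1 f -> (Ddepth f <= depth_dtree t)%N.
Proof.
rewrite /Ddepth; case: ex_minnP => k _ kmin tf; apply: kmin.
by apply/asboolP; exists t.
Qed.

Lemma Ddepth_ex f : exists2 t, eval_dtree t =1 f & depth_dtree t = Ddepth f.
Proof. by rewrite /Ddepth; case: ex_minnP => k /asboolP. Qed.

Lemma Ddepth_const b : Ddepth (fun _ : n.-tuple bool => b) = 0%N.
Proof. by apply/eqP; rewrite -leqn0; apply: (@Ddepth_le _ (DLeaf n b)). Qed.

Lemma Ddepth_negb f : Ddepth (fun x => ~~ f x) = Ddepth f.
Proof.
have le (h : boolfun n) : (Ddepth (fun x => ~~ h x) <= Ddepth h)%N.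
  pose fix neg t : dtree n := match t with
    | DLeaf b => DLeaf n (~~ b)
    | DNode i t0 t1 => DNode i (neg t0) (neg t1) end.
  have [t th <-] := Ddepth_ex h.
  have <- : depth_dtree (neg t) = depth_dtree t.
    by elim: {th} t => //= i t0 -> t1 ->.
  apply: Ddepth_le => x; rewrite -th.
  by elim: {th} t => //= i t0 -> t1 ->; case: ifP.
apply/eqP; rewrite eqn_leq le /=.
have /= := le (fun x => ~~ f x).
suff -> : (fun x => ~~ ~~ f x) = f by [].
by apply/funext => x; rewrite negbK.
Qed.

Lemma Ddepth_leq_dim f : (Ddepth f <= n)%N.
Proof.
set t := query_all f (enum 'I_n) [tuple false | _ < n].
have tn : n = depth_dtree t.
  rewrite -[LHS]card_ord cardE /t; move: [tuple _ | _ < n].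
  by elim: (enum 'I_n) => //= i s IH x; rewrite -!IH maxnn.
by rewrite [leqRHS]tn; apply: Ddepth_le => x; apply: eval_query_all => i; rewrite mem_enum.
Qed.

Definition override r1 r2 : restriction n :=
  fun i => if r1 i is Some b then Some b else r2 i.

Definition rset r u o : restriction n := fun i => if i == u then o else r i.

Lemma restrict_override f r1 r2 :
  restrict (restrict f r1) r2 = restrict f (override r1 r2).
Proof.
apply/funext => x; rewrite /restrict; congr f; apply: eq_from_tnth => i.
by rewrite !tnth_mktuple /override; case: (r1 i).
Qed.

Lemma Ddepth_restrict f r : (Ddepth (restrict f r) <= Ddepth f)%N.
Proof.
pose fix sub t : dtree n := match t with
  | DLeaf b => DLeaf n b
  | DNode i t0 t1 => match r i with
      | Some b => if b then sub t1 else sub t0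
      | None => DNode i (sub t0) (sub t1) end end.
have [t tf <-] := Ddepth_ex f.
apply: (@leq_trans (depth_dtree (sub t))).
  apply: Ddepth_le => x; rewrite /restrict -tf.
  elim: {tf} t => //= i t0 IH0 t1 IH1; rewrite tnth_mktuple.
  by case: (r i) => [[]|] /=; rewrite -?IH0 -?IH1.
elim: {tf} t => //= i t0 IH0 t1 IH1.
by case: (r i) => [[]|] /=; lia.
Qed.

Lemma Ddepth_restrict_le f r r' :
  (forall i b, r i = Some b -> r' i = Some b) ->
  (Ddepth (restrict f r') <= Ddepth (restrict f r))%N.
Proof.
move=> rr'; suff <- : override r r' = r'.
  by rewrite -restrict_override; exact: Ddepth_restrict.
apply/funext => i; rewrite /override; case E : (r i) => [b|//].
by rewrite (rr' _ _ E).
Qed.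

Lemma restrict_eq f g r :
  (forall x : n.-tuple bool, (forall i b, r i = Some b -> tnth x i = b) -> f x = g x) ->
  restrict f r = restrict g r.
Proof.
move=> fg; apply/funext => x; apply: fg => i b ri.
by rewrite tnth_mktuple ri.
Qed.

Lemma Ddepth_query f r u s : (s <= Ddepth (restrict f r))%N ->
  exists b, (s.-1 <= Ddepth (restrict f (rset r u (Some b))))%N.
Proof.
move=> sD; case ru : (r u) => [b|].
  exists b; suff -> : rset r u (Some b) = r by lia.
  by apply/funext => i; rewrite /rset; case: eqP => // ->.
have [t0 t0f t0d] := Ddepth_ex (restrict f (rset r u (Some false))).
have [t1 t1f t1d] := Ddepth_ex (restrict f (rset r u (Some true))).
have /(leq_trans sD) : (Ddepth (restrict f r) <= depth_dtree (DNode u t0 t1))%N.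
  apply: Ddepth_le => x /=; rewrite t0f t1f /restrict.
  have E b : tnth x u = b ->
      [tuple odflt (tnth x i) (rset r u (Some b) i) | i < n] =
      [tuple odflt (tnth x i) (r i) | i < n].
    move=> xu; apply: eq_from_tnth => i; rewrite !tnth_mktuple /rset.
    by case: eqP => // ->; rewrite ru /= xu.
  by case xu : (tnth x u); rewrite (E _ xu).
rewrite /= t0d t1d => s_le.
have [?|?] : (s.-1 <= Ddepth (restrict f (rset r u (Some false))) \/
   s.-1 <= Ddepth (restrict f (rset r u (Some true))))%N by lia.
- by exists false.
- by exists true.
Qed.

End decision_tree_depth.

(** * Switching lemma *)

Section switching.
Context (R : realFieldType) (n : nat) (p alpha y : R).
Hypotheses (p0 : 0 <= p) (p1 : p < 1).
Hypotheses (alpha0 : 0 <= alpha) (alpha1 : alpha <= 1) (y0 : 0 <= y).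
Hypothesis (pya : p <= (1 - p) / 2 * (y * alpha)).

Local Notation rst := {ffun 'I_n -> option bool}.
Implicit Types (rho : rst) (theta : restriction n) (D : {set rst}).
Implicit Types (g : boolfun n) (l : 'I_n * bool) (U T : seq ('I_n * bool)).

Definition star_weight (o : option bool) : R :=
  if o is Some _ then (1 - p) / 2 else p.

Definition rst_weight rho : R := \prod_i star_weight (rho i).

Definition fset_at rho (u : 'I_n) o : rst :=
  [ffun i => if i == u then o else rho i].

Definition fix_closed D :=
  forall rho u b, rho \in D -> rho u = None -> fset_at rho u (Some b) \in D.

Definition alive U rho :=
  all (fun l => (rho l.1 == None) || (rho l.1 == Some l.2)) U.
Definition satisfied U rho := all (fun l => rho l.1 == Some l.2) U.

Definition term_eval T : boolfun n := fun x => all (fun l => tnth x l.1 == l.2) T.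

#[local] Arguments term_eval : simpl never.

Definition switch_bound g := forall theta s D, fix_closed D ->
  \sum_(rho in D) rst_weight rho * (s <= Ddepth (restrict g (override theta rho)))%:R
  <= alpha ^+ s * \sum_(rho in D) rst_weight rho.

Lemma rst_weight_ge0 rho : 0 <= rst_weight rho.
Proof.
apply: prodr_ge0 => i _; rewrite /star_weight; case: (rho i) => // _.
by apply: divr_ge0; rewrite ?subr_ge0 // ltW.
Qed.

Lemma rst_weight_star rho u b : rho u = Some b ->
  rst_weight (fset_at rho u None) <= y * alpha * rst_weight rho.
Proof.
move=> ru; rewrite /rst_weight (bigD1 u) //= [X in _ <= _ * X](bigD1 u) //=.
rewrite ffunE eqxx ru /= mulrA.
have -> : \prod_(i < n | i != u) star_weight (fset_at rho u None i) =
          \prod_(i < n | i != u) star_weight (rho i).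
  by apply: eq_bigr => i iu; rewrite ffunE (negbTE iu).
apply: ler_wpM2r; last by rewrite mulrC.
apply: prodr_ge0 => i _; rewrite /star_weight; case: (rho i) => // _.
by apply: divr_ge0; rewrite ?subr_ge0 // ltW.
Qed.

Lemma alive_set_at U rho u o : u \notin unzip1 U ->
  alive U (fset_at rho u o) = alive U rho.
Proof.
move=> uU; apply: eq_in_all => l lU; rewrite ffunE.
case: (l.1 =P u) => // lu; case/negP: uU; rewrite -lu; exact: map_f.
Qed.

Lemma override_set_at theta rho u o b :
  override (rset theta u (Some b)) (fset_at rho u o) =
  override (rset theta u (Some b)) rho.
Proof.
by apply/funext => i; rewrite /override /rset ffunE; case: eqP.
Qed.

Lemma override_rset theta rho u b :
  override (rset theta u (Some b)) rho = rset (override theta rho) u (Some b).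
Proof. by apply/funext => i; rewrite /override /rset; case: eqP. Qed.

Definition fixed_part D u b : {set rst} := [set rho in D | rho u == Some b].

Definition starred_part D u b : {set rst} :=
  [set rho : rst | (rho u == Some b) && (fset_at rho u None \in D)].

Lemma fixed_part_closed D u b : fix_closed D -> fix_closed (fixed_part D u b).
Proof.
move=> cD rho v c; rewrite !inE => /andP[rD /eqP ru] rv.
rewrite cD //= ffunE; case: (u =P v) => [uv|_]; last exact/eqP.
by move: ru; rewrite uv rv.
Qed.

Lemma starred_part_closed D u b : fix_closed D -> fix_closed (starred_part D u b).
Proof.
move=> cD rho v c; rewrite !inE => /andP[/eqP ru rD] rv.
have uv : u != v by apply/eqP => uv; rewrite uv rv in ru.
rewrite ffunE (negbTE uv) ru eqxx /=.
have -> : fset_at (fset_at rho v (Some c)) u None =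
          fset_at (fset_at rho u None) v (Some c).
  apply/ffunP => i; rewrite !ffunE.
  by case: eqP => // ->; rewrite (negbTE uv).
by apply: cD => //; rewrite ffunE eq_sym (negbTE uv).
Qed.

Lemma starred_part_sub D u b : fix_closed D ->
  {subset starred_part D u b <= fixed_part D u b}.
Proof.
move=> cD rho; rewrite !inE => /andP[/eqP ru rD]; rewrite ru eqxx andbT.
have := cD _ u b rD; rewrite ffunE eqxx => /(_ erefl).
suff -> : fset_at (fset_at rho u None) u (Some b) = rho by [].
by apply/ffunP => i; rewrite !ffunE; case: eqP => // ->.
Qed.

Definition alive_mass D U g theta s :=
  \sum_(rho in D | alive U rho)
    rst_weight rho * (s <= Ddepth (restrict g (override theta rho)))%:R.

Definition sat_mass D U := \sum_(rho in D | satisfied U rho) rst_weight rho.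

Lemma sat_mass_ge0 D U : 0 <= sat_mass D U.
Proof. by apply: sumr_ge0 => rho _; exact: rst_weight_ge0. Qed.

Lemma sat_mass_cons D l U : sat_mass (fixed_part D l.1 l.2) U = sat_mass D (l :: U).
Proof. by apply: eq_bigl => rho; rewrite !inE /= -andbA. Qed.

Lemma sat_mass_starred D l U : fix_closed D ->
  sat_mass (starred_part D l.1 l.2) U <= sat_mass D (l :: U).
Proof.
move=> cD; rewrite -sat_mass_cons /sat_mass [leRHS]big_mkcond [leLHS]big_mkcond.
apply: ler_sum => rho _; case: ifP => [/andP[/(starred_part_sub cD) -> -> //]|_].
by case: ifP => // _; exact: rst_weight_ge0.
Qed.

Lemma alive_mass_starred D u b c U g theta s : u \notin unzip1 U ->
  \sum_(rho in D | (rho u == None) && alive U rho)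
    rst_weight rho *
      (s <= Ddepth (restrict g (override (rset theta u (Some c)) rho)))%:R <=
  y * alpha * alive_mass (starred_part D u b) U g (rset theta u (Some c)) s.
Proof.
move=> uU; rewrite (reindex_onto (fun rho => fset_at rho u None)
  (fun rho => fset_at rho u (Some b))) /=; last first.
  move=> rho /andP[_ /andP[/eqP ru _]]; apply/ffunP => i; rewrite !ffunE.
  by case: eqP => // ->; rewrite ru.
rewrite /alive_mass mulr_sumr.
rewrite (eq_bigl (fun rho => (rho \in starred_part D u b) && alive U rho)).
  apply: ler_sum => rho /andP[]; rewrite inE => /andP[/eqP ru _] _.
  rewrite override_set_at mulrA; apply: ler_wpM2r => //.
  exact: rst_weight_star ru.
move=> rho; rewrite inE !ffunE eqxx /= alive_set_at //.
suff -> : (fset_at (fset_at rho u None) u (Some b) == rho) = (rho u == Some b).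
  by case: (_ \in D); case: (alive U rho); rewrite ?andbF ?andbT.
apply/eqP/eqP => [<-|ru]; first by rewrite !ffunE eqxx.
by apply/ffunP => i; rewrite !ffunE; case: eqP => // ->.
Qed.

Lemma alive_mass_cons D l U g theta s :
  alive_mass D (l :: U) g theta s =
  alive_mass (fixed_part D l.1 l.2) U g theta s +
  \sum_(rho in D | (rho l.1 == None) && alive U rho)
    rst_weight rho * (s <= Ddepth (restrict g (override theta rho)))%:R.
Proof.
rewrite /alive_mass (bigID (fun rho : rst => rho l.1 == None)) /= addrC.
by congr (_ + _); apply: eq_bigl => rho; rewrite ?inE /=;
   case: (_ \in D); case: (rho l.1) => [[]|] //=; case: (l.2);
   case: (alive _ _).
Qed.

Lemma alive_mass_switch g U D theta s : switch_bound g -> fix_closed D ->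
  uniq (unzip1 U) ->
  alive_mass D U g theta s <= (1 + 2 * y) ^+ size U * (alpha ^+ s * sat_mass D U).
Proof.
move=> gb; elim: U D theta s => [|l U IH] D theta s cD uU.
  rewrite /= expr0 mul1r /alive_mass /sat_mass /=.
  by under eq_bigl do rewrite andbT; under [in leRHS]eq_bigl do rewrite andbT; exact: gb.
move: uU => /= /andP[lU uU]; rewrite alive_mass_cons.
have A := IH _ theta s (fixed_part_closed (b := l.2) (u := l.1) cD) uU.
have B c := IH _ (rset theta l.1 (Some c)) s.-1
  (starred_part_closed (b := l.2) (u := l.1) cD) uU.
rewrite sat_mass_cons in A.
set M := sat_mass D (l :: U) in A *.
have M0 : 0 <= M by exact: sat_mass_ge0.
set P := (1 + 2 * y) ^+ size U in A B *.
have P0 : 0 <= P by apply: exprn_ge0; rewrite addr_ge0 ?mulr_ge0.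
have sa : alpha * alpha ^+ s.-1 <= alpha ^+ s.
  by case: s {A B} => [|s] /=; rewrite ?expr0 ?mulr1 // exprS.
have C c : y * alpha * alive_mass (starred_part D l.1 l.2) U g
    (rset theta l.1 (Some c)) s.-1 <= y * (P * (alpha ^+ s * M)).
  apply: (@le_trans _ _ (y * alpha * (P * (alpha ^+ s.-1 * M)))).
    apply: ler_wpM2l; first by rewrite mulr_ge0.
    apply: le_trans (B c) _; apply: ler_wpM2l => //; apply: ler_wpM2l.
      exact: exprn_ge0.
    exact: sat_mass_starred.
  have -> : y * alpha * (P * (alpha ^+ s.-1 * M)) =
     y * (P * (alpha * alpha ^+ s.-1 * M)) by ring.
  by do 2!apply: ler_wpM2l => //; apply: ler_wpM2r.
have E : \sum_(rho in D | (rho l.1 == None) && alive U rho)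
    rst_weight rho * (s <= Ddepth (restrict g (override theta rho)))%:R <=
  \sum_(c : bool) y * alpha * alive_mass (starred_part D l.1 l.2) U g
    (rset theta l.1 (Some c)) s.-1.
  apply: le_trans (ler_sum _ (fun c _ => @alive_mass_starred D l.1 l.2 c U g theta s.-1 lU)).
  rewrite exchange_big; apply: ler_sum => rho _.
  rewrite -mulr_sumr; apply: ler_wpM2l; first exact: rst_weight_ge0.
  rewrite -natr_sum ler_nat; case: (leqP s (Ddepth (restrict g (override theta rho)))) => // sD.
  have [c] := Ddepth_query l.1 sD; rewrite -override_rset => h; by rewrite (bigD1 c) //= h.
rewrite exprS -/P; apply: le_trans (lerD A E) _.
rewrite big_bool /=; have := C true; have := C false; rewrite -/P -/M.
set X := P * (alpha ^+ s * M); have -> : (1 + 2 * y) * P * (alpha ^+ s * M) =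
  X + 2 * (y * X) by rewrite /X; ring.
by move=> /=; lra.
Qed.

(* A path that follows [T] to the end satisfies the disjunction, so only the
   answers deviating from [T] somewhere are charged: hence the difference. *)
Lemma alive_mass_term g g' T U D theta s :
  switch_bound g' -> fix_closed D -> uniq (unzip1 U) -> (0 < s)%N ->
  (forall x, g x = term_eval T x || g' x) ->
  {subset U <= T} -> {in U, forall l, theta l.1 = None} ->
  {in T, forall l, l \in U \/ theta l.1 = Some l.2} ->
  alive_mass D U g theta s <=
  ((1 + 2 * y) ^+ size U - (1 + y) ^+ size U) * (alpha ^+ s * sat_mass D U).
Proof.
move=> gb' + + + gE; elim: U D theta s => [|l U IH] D theta s cD uU s0 UT Uth Tth.
  rewrite /= !expr0 subrr mul0r /alive_mass big1 // => rho _.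
  have -> : restrict g (override theta rho) = restrict (fun=> true) (override theta rho).
    apply: restrict_eq => x xr; rewrite gE; apply/orP; left.
    apply/allP => l lT; apply/eqP; apply: xr.
    by rewrite /override; case: (Tth _ lT) => [//|->].
  by rewrite /restrict Ddepth_const leqNgt s0 mulr0.
move: uU => /= /andP[lU uU]; rewrite alive_mass_cons.
have lN l' : l' \in U -> l'.1 != l.1.
  by move=> l'U; apply/eqP => e; case/negP: lU; rewrite -e; exact: map_f.
have setTh l' : l' \in U -> forall c, rset theta l.1 (Some c) l'.1 = None.
  by move=> l'U c; rewrite /rset (negbTE (lN _ l'U)) Uth // inE l'U orbT.
have UT' : {subset U <= T} by move=> l' l'U; apply: UT; rewrite inE l'U orbT.
have Tth' : {in T, forall l', l' \in U \/ rset theta l.1 (Some l.2) l'.1 = Some l'.2}.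
  move=> l' /Tth; rewrite inE => -[/orP[/eqP ->|]|b]; [right|left|right] => //.
    by rewrite /rset eqxx.
  rewrite /rset; case: eqP => // e.
  by move: b; rewrite e Uth ?inE ?eqxx.
have th0 : theta l.1 = None by apply: Uth; rewrite inE eqxx.
have A : alive_mass (fixed_part D l.1 l.2) U g theta s <=
    ((1 + 2 * y) ^+ size U - (1 + y) ^+ size U) * (alpha ^+ s * sat_mass D (l :: U)).
  rewrite -sat_mass_cons; apply: le_trans (IH _ (rset theta l.1 (Some l.2)) s
    (fixed_part_closed (b := l.2) (u := l.1) cD) uU s0 UT' _ Tth').
    rewrite /alive_mass; apply: ler_sum => rho /andP[]; rewrite inE.
    move=> /andP[_ /eqP rl] _; rewrite override_rset.
    suff <- : override theta rho = rset (override theta rho) l.1 (Some l.2) by [].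
    by apply/funext => i; rewrite /rset; case: eqP => // ->; rewrite /override th0.
  by move=> l' /setTh.
have B : y * alpha * alive_mass (starred_part D l.1 l.2) U g'
    (rset theta l.1 (Some (~~ l.2))) s.-1 <= y * alpha * ((1 + 2 * y) ^+ size U *
      (alpha ^+ s.-1 * sat_mass D (l :: U))).
  apply: ler_wpM2l; first by rewrite mulr_ge0.
  apply: le_trans (alive_mass_switch _ _ gb' (starred_part_closed cD) uU) _.
  apply: ler_wpM2l; first by apply: exprn_ge0; rewrite addr_ge0 ?mulr_ge0.
  by apply: ler_wpM2l; [exact: exprn_ge0|exact: sat_mass_starred].
have C : y * alpha * ((0 < s.-1)%:R * alive_mass (starred_part D l.1 l.2) U g
    (rset theta l.1 (Some l.2)) s.-1) <= y * alpha * (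
    ((1 + 2 * y) ^+ size U - (1 + y) ^+ size U) * (alpha ^+ s.-1 * sat_mass D (l :: U))).
  have P0 : 0 <= (1 + 2 * y) ^+ size U - (1 + y) ^+ size U.
    rewrite subr_ge0; apply: lerXn2r; rewrite ?nnegrE ?addr_ge0 ?mulr_ge0 //.
    by rewrite lerD2l mulr_natl mulr2n lerDl.
  apply: ler_wpM2l; first by rewrite mulr_ge0.
  have [s1|_] := ltnP 0 s.-1; last first.
    by rewrite mul0r; rewrite !mulr_ge0 // ?exprn_ge0 // sat_mass_ge0.
  rewrite mul1r; apply: le_trans (IH _ _ s.-1 (starred_part_closed cD) uU s1 UT' _ Tth') _.
    by move=> l' /setTh.
  by apply: ler_wpM2l => //; apply: ler_wpM2l; [exact: exprn_ge0|exact: sat_mass_starred].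
have E : \sum_(rho in D | (rho l.1 == None) && alive U rho)
    rst_weight rho * (s <= Ddepth (restrict g (override theta rho)))%:R <=
  y * alpha * alive_mass (starred_part D l.1 l.2) U g'
    (rset theta l.1 (Some (~~ l.2))) s.-1 +
  y * alpha * ((0 < s.-1)%:R * alive_mass (starred_part D l.1 l.2) U g
    (rset theta l.1 (Some l.2)) s.-1).
  rewrite [X in _ <= _ + X]mulrCA.
  apply: le_trans (lerD (@alive_mass_starred D l.1 l.2 _ U g' theta s.-1 lU)
    (ler_wpM2l _ (@alive_mass_starred D l.1 l.2 _ U g theta s.-1 lU))); last by [].
  rewrite mulr_sumr -big_split /=; apply: ler_sum => rho _.
  rewrite mulrCA -mulrDr; apply: ler_wpM2l; first exact: rst_weight_ge0.
  rewrite -natrM -natrD ler_nat; case: (leqP s (Ddepth (restrict g (override theta rho)))) => // sD.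
  have gg' : restrict g (override (rset theta l.1 (Some (~~ l.2))) rho) =
             restrict g' (override (rset theta l.1 (Some (~~ l.2))) rho).
    apply: restrict_eq => x xr; rewrite gE.
    suff -> : term_eval T x = false by [].
    apply/negbTE/allPn; exists l; first by apply: UT; rewrite inE eqxx.
    by rewrite (xr _ (~~ l.2)) ?eqb_id /override /rset ?eqxx //; case: (l.2).
  have [c] := Ddepth_query l.1 sD; rewrite -override_rset.
  have [->|] := eqVneq c (~~ l.2); first by rewrite gg' => ->.
  move=> cl; have -> : c = l.2 by move: cl; case: c; case: (l.2).
  case: (posnP s.-1) => [->|s1 ->]; first by rewrite leq0n.
  by rewrite mul1n addn1.
apply: le_trans (lerD A E) _; apply: le_trans (lerD (lexx _) (lerD B C)) _.
rewrite !exprS -[in alpha ^+ s](prednK s0) exprS.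
by rewrite le_eqVlt; apply/orP; left; apply/eqP; ring.
Qed.

Lemma switching_lemma k (L : seq (seq ('I_n * bool))) :
  (forall t, (t <= k)%N -> (1 + 2 * y) ^+ t - (1 + y) ^+ t <= 1) ->
  (forall T, T \in L -> uniq (unzip1 T) /\ (size T <= k)%N) ->
  switch_bound (fun x => has (term_eval^~ x) L).
Proof.
move=> yk; elim: L => [|T L IH] HL theta s D cD.
  rewrite mulr_sumr.
  case: s => [|s]; first by rewrite expr0; apply: ler_sum => rho _; rewrite leq0n mulr1 mul1r.
  rewrite big1 ?sumr_ge0 // => rho _; rewrite ?mulr_ge0 ?exprn_ge0 ?rst_weight_ge0 //.
  by rewrite /restrict /= Ddepth_const mulr0.
have {}IH : switch_bound (fun x => has (term_eval^~ x) L).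
  by apply: IH => T' T'L; apply: HL; rewrite inE T'L orbT.
set g := (fun x => has (term_eval^~ x) (T :: L)).
set g' := (fun x => has (term_eval^~ x) L) in IH.
have gE x : g x = term_eval T x || g' x by [].
case: s => [|s].
  by rewrite expr0 mul1r; apply: ler_sum => rho _; rewrite mulr1.
have [Tu Tk] := HL T (mem_head _ _).
have falsified (r : restriction n) l : l \in T -> r l.1 = Some (~~ l.2) ->
    restrict g r = restrict g' r.
  move=> lT rl; apply: restrict_eq => x xr; rewrite gE.
  suff -> : term_eval T x = false by [].
  by apply/negbTE/allPn; exists l => //; rewrite (xr _ _ rl); case: (l.2).
have [/hasP[l lT /eqP thl]|/hasPn Tth] :=
    boolP (has (fun l => theta l.1 == Some (~~ l.2)) T).
  apply: le_trans (IH theta s.+1 D cD); apply: ler_sum => rho _.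
  by rewrite (falsified _ l lT) // /override thl.
pose U := [seq l <- T | theta l.1 == None].
have Uu : uniq (unzip1 U).
  by apply: subseq_uniq Tu; apply: map_subseq; exact: filter_subseq.
have Uk : (size U <= k)%N by apply: leq_trans Tk; rewrite size_filter count_size.
have dead_closed : fix_closed [set rho in D | ~~ alive U rho].
  move=> rho u b; rewrite !inE => /andP[rD /allPn[l lU]] ru ru0.
  rewrite cD //=; apply/allPn; exists l => //; rewrite ffunE.
  by case: (l.1 =P u) ru => // ->; rewrite ru0.
rewrite [leLHS](bigID (alive U)) [X in _ <= _ * X](bigID (alive U)) /= mulrDr.
apply: lerD.
  apply: le_trans (@alive_mass_term g g' T U D theta s.+1 IH cD Uu _ gE _ _ _) _ => //.
  - by move=> l; rewrite mem_filter => /andP[].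
  - by move=> l; rewrite mem_filter => /andP[/eqP].
  - move=> l lT; have := Tth _ lT; rewrite mem_filter lT andbT.
    by case: (theta l.1) => [b|]; [right|left] => //; move: H; case: b; case: (l.2).
  apply: (@le_trans _ _ (alpha ^+ s.+1 * sat_mass D U)).
    rewrite -[leRHS]mul1r; apply: ler_wpM2r; last exact: yk.
    by rewrite mulr_ge0 ?exprn_ge0 ?sat_mass_ge0.
  apply: ler_wpM2l; first exact: exprn_ge0.
  rewrite /sat_mass [leLHS]big_mkcond [leRHS]big_mkcond; apply: ler_sum => rho _.
  case: ifP => [/andP[-> /allP sU]|_]; last by case: ifP => // _; exact: rst_weight_ge0.
  have -> // : alive U rho.
  by apply/allP => l /sU ->; rewrite orbT.
have dE rho : (rho \in D) && ~~ alive U rho = (rho \in [set rho in D | ~~ alive U rho]).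
  by rewrite inE.
rewrite (eq_bigl _ _ dE) [X in _ <= _ * X](eq_bigl _ _ dE).
apply: le_trans (IH theta s.+1 _ dead_closed); apply: ler_sum => rho.
rewrite inE => /andP[_ /allPn[l]]; rewrite mem_filter => /andP[/eqP th lT] rl.
rewrite (falsified _ l lT) // /override th.
by move: rl; case: (rho l.1) => // b; case: b; case: (l.2).
Qed.

Definition drop_var (i : 'I_n) T := [seq l <- T | l.1 != i].

Fixpoint dtree_terms (t : dtree n) : seq (seq ('I_n * bool)) :=
  match t with
  | DLeaf b => if b then [:: [::]] else [::]
  | DNode i t0 t1 =>
      [seq (i, false) :: drop_var i T | T <- dtree_terms t0 & (i, true) \notin T] ++
      [seq (i, true) :: drop_var i T | T <- dtree_terms t1 & (i, false) \notin T]
  end.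

Lemma term_eval_query T i b x : (i, ~~ b) \notin T ->
  term_eval ((i, b) :: drop_var i T) x = (tnth x i == b) && term_eval T x.
Proof.
move=> iT; rewrite /term_eval /=; case: eqP => //= xi.
apply/allP/allP => h l lT.
  have [li|li] := eqVneq l.1 i; last by apply: h; rewrite mem_filter li.
  rewrite li xi eq_sym; apply/negPn/negP => lb; case/negP: iT.
  by case: l li lb lT {h} => /= _ c -> cb; have -> : c = ~~ b by case: c b cb {xi} => [] [].
by apply: h; move: lT; rewrite mem_filter => /andP[].
Qed.

Lemma has_query_terms i b (L : seq (seq ('I_n * bool))) x :
  has (term_eval^~ x) [seq (i, b) :: drop_var i T | T <- L & (i, ~~ b) \notin T] =
  (tnth x i == b) && has (term_eval^~ x) L.
Proof.
elim: L => [|T L IH] /=; first by rewrite andbF.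
case: ifPn => [iT|/negPn iT] /=; first by rewrite IH term_eval_query // andb_orr.
rewrite IH; case: eqP => //= xi.
suff -> : term_eval T x = false by [].
by apply/negbTE/allPn; exists (i, ~~ b) => //=; rewrite xi; case: (b).
Qed.

Lemma dtree_termsE t x : eval_dtree t x = has (term_eval^~ x) (dtree_terms t).
Proof.
elim: t => [[]|i t0 IH0 t1 IH1] //=.
rewrite has_cat (has_query_terms _ false) (has_query_terms _ true) -IH0 -IH1.
by case: (tnth x i) => //=; rewrite orbF.
Qed.

Lemma dtree_terms_bounded t T : T \in dtree_terms t ->
  uniq (unzip1 T) /\ (size T <= depth_dtree t)%N.
Proof.
have ext i b T' m : uniq (unzip1 T') -> (size T' <= m)%N ->
    uniq (unzip1 ((i, b) :: drop_var i T')) /\ (size ((i, b) :: drop_var i T') <= m.+1)%N.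
  move=> uT sT; split => /=.
    apply/andP; split; last first.
      by apply: subseq_uniq uT; apply: map_subseq; exact: filter_subseq.
    by apply/mapP => -[l]; rewrite mem_filter => /andP[/eqP li _] /esym.
  by rewrite ltnS; apply: leq_trans sT; rewrite size_filter count_size.
elim: t T => [b|i t0 IH0 t1 IH1] T /=; first by case: b => //; rewrite inE => /eqP ->.
rewrite mem_cat => /orP[] /mapP[T']; rewrite mem_filter => /andP[_].
  by move=> /IH0[u s] ->; apply: ext => //; lia.
by move=> /IH1[u s] ->; apply: ext => //; lia.
Qed.

Lemma switching_or k (fs : seq (boolfun n)) :
  (forall t, (t <= k)%N -> (1 + 2 * y) ^+ t - (1 + y) ^+ t <= 1) ->
  all (fun f => (Ddepth f <= k)%N) fs ->
  switch_bound (fun x => has (fun f => f x) fs).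
Proof.
move=> yk fk.
suff [L LE Lk] : exists2 L : seq (seq ('I_n * bool)),
    forall x, has (fun f => f x) fs = has (term_eval^~ x) L &
    forall T, T \in L -> uniq (unzip1 T) /\ (size T <= k)%N.
  have -> : (fun x => has (fun f => f x) fs) = (fun x => has (term_eval^~ x) L).
    exact/funext.
  exact: switching_lemma Lk.
elim: fs fk => [_|f fs IH /= /andP[fk /IH[L LE Lk]]]; first by exists [::].
have [t tf td] := Ddepth_ex f; exists (dtree_terms t ++ L) => [x|T].
  by rewrite has_cat -LE -dtree_termsE tf.
rewrite mem_cat => /orP[/dtree_terms_bounded[Tu Tk]|/Lk//].
by split => //; apply: leq_trans Tk _; rewrite td.
Qed.

Lemma sum_rst_weight : \sum_rho rst_weight rho = 1.
Proof.
rewrite -(bigA_distr_bigA (fun _ : 'I_n => star_weight)) /= big1 // => i _.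
rewrite (bigD1 None) //= (bigD1 (Some true)) //= (bigD1 (Some false)) //= big1.
  by field.
by case=> [[]|].
Qed.

End switching.

Lemma switching_gate (R : realType) n (k : nat) (a : R) (b : bool)
    (fs : seq (boolfun n)) s :
  (0 < k)%N -> 0 < a <= 1 -> all (fun f => (Ddepth f <= k)%N) fs ->
  \sum_rho rst_weight (a / (14 * k%:R)) rho *
    (s <= Ddepth (restrict (fun x => b (+) has (fun f => f x) fs)
       (rho : {ffun 'I_n -> option bool})))%:R
  <= (a / expR 1) ^+ s.
Proof.
move=> k0 /andP[a0 a1] fsk.
have k1 : 1 <= k%:R :> R by rewrite ler1n.
have kp : 0 < k%:R :> R by rewrite ltr0n.
have e0 : 0 < expR 1 :> R by exact: expR_gt0.
have e1 : 1 <= expR 1 :> R by apply: le_trans (expR_ge1Dx 1); lra.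
have expB (x : R) m : 0 <= 1 - x / m.+1%:R -> (1 - x / m.+1%:R) ^+ m.+1 * expR x <= 1.
  move=> h; rewrite -[leRHS](expRxMexpNx_1 x) mulrC; apply: ler_wpM2l; first exact: expR_ge0.
  have -> : - x = (- x / m.+1%:R) * m.+1%:R by rewrite divfK.
  rewrite expRM_natr; apply: lerXn2r; rewrite ?nnegrE ?expR_ge0 //.
  by apply: le_trans (expR_ge1Dx _); rewrite mulNr.
have e3 : expR 1 <= 3 :> R.
  have := @expB 1 7%N; set E := expR 1; lra.
pose y : R := 6 / (13 * k%:R).
have y0 : 0 <= y by rewrite /y divr_ge0 // mulr_ge0 // ltW.
have ky : k%:R * y = 6 / 13 by rewrite /y; field; rewrite gt_eqF.
set p := a / (14 * k%:R).
have p14 : p <= 1 / 14.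
  rewrite /p ler_pdivrMr; last by rewrite mulr_gt0.
  by rewrite mulrA mul1r mulVf // mul1r (le_trans a1).
have pa : 14 * k%:R * p = a by rewrite /p mulrC divfK // gt_eqF // mulr_gt0.
have p0 : 0 <= p by rewrite /p divr_ge0 ?mulr_ge0 // ltW.
have yk t : (t <= k)%N -> (1 + 2 * y) ^+ t - (1 + y) ^+ t <= 1.
  move=> tk; set z := (1 + y) ^+ t.
  have z0 : 1 <= z by apply: exprn_ege1; lra.
  have zE : z <= expR (6 / 13).
    rewrite -ky expRM_natl; apply: le_trans (_ : (1 + y) ^+ k <= _).
      by apply: ler_weXn2l tk; lra.
    by apply: lerXn2r; rewrite ?nnegrE ?expR_ge0 ?expR_ge1Dx //; lra.
  have z2 : (1 + 2 * y) ^+ t <= z ^+ 2.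
    rewrite /z -exprM mulnC exprM; apply: lerXn2r; rewrite ?nnegrE; nra.
  have : expR (6 / 13) <= 161 / 100 :> R.
    have := @expB (6 / 13) 7%N; set E := expR _; lra.
  by move: z2; set w := (1 + 2 * y) ^+ t; nra.
have pya : p <= (1 - p) / 2 * (y * (a / expR 1)).
  have -> : (1 - p) / 2 * (y * (a / expR 1)) = p * (1 - p) * (42 / 13) / expR 1.
    rewrite -pa /y; field; by rewrite !gt_eqF.
  rewrite ler_pdivlMr // -[leRHS]mulrA; apply: ler_wpM2l => //.
  apply: le_trans e3 _; move: p14; clear; lra.
have alpha1 : a / expR 1 <= 1 by rewrite ler_pdivrMr // mul1r (le_trans a1).
have alpha0 : 0 <= a / expR 1 by rewrite divr_ge0 ?ltW.
have p1 : p < 1 by lra.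
have cT : fix_closed [set: {ffun 'I_n -> option bool}] by move=> *; rewrite inE.
have := switching_or p0 p1 alpha0 alpha1 y0 pya yk fsk (fun=> None) s cT.
rewrite (eq_bigl (fun=> true)) => [|rho]; last by rewrite inE.
rewrite [X in _ <= _ * X](eq_bigl (fun=> true)) => [|rho]; last by rewrite inE.
rewrite sum_rst_weight mulr1; apply: le_trans.
apply: ler_sum => rho _; rewrite /override; case: b => //=.
by rewrite [X in (s <= X)%N](Ddepth_negb (restrict (fun x => has (fun f => f x) fs) rho)).
Qed.


(** * Finite product weights and discretization *)

Section product_weight.
Context (R : realFieldType) (n : nat).

Definition product_weight (A : finType) (mu : A -> R) (w : {ffun 'I_n -> A}) : R :=
  \prod_i mu (w i).

Lemma product_weight_map (A B : finType) (mu : A -> R) (nu : B -> R) (g : A -> B)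
    (F : {ffun 'I_n -> B} -> R) :
  (forall b, \sum_(a | g a == b) mu a = nu b) ->
  \sum_w product_weight mu w * F [ffun i => g (w i)] =
  \sum_rho product_weight nu rho * F rho.
Proof.
move=> gnu; rewrite (partition_big (fun w : {ffun 'I_n -> A} => [ffun i => g (w i)]) predT) //=.
apply: eq_bigr => rho _.
rewrite (eq_bigr (fun w => product_weight mu w * F rho)) => [|w /eqP -> //].
rewrite -mulr_suml; congr (_ * _).
rewrite /product_weight (eq_bigr (fun i => \sum_(a | g a == rho i) mu a)) => [|i _ //].
rewrite bigA_distr_big_dep /=; apply: eq_bigl => w; apply/eqP/familyP => [wr i|wr].
  by rewrite unfold_in -wr ffunE.
by apply/ffunP => i; rewrite ffunE; apply/eqP; exact: wr.
Qed.

Definition mix (A : finType) (K : pred A) (w w' : {ffun 'I_n -> A}) :=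
  [ffun i => if K (w i) then w' i else w i].

Definition cond_weight (A : finType) (mu : A -> R) (K : pred A) (a : A) : R :=
  if K a then mu a / \sum_(b | K b) mu b else 0.

(* Coordinates in [K] may be redrawn from the law conditioned on [K]. *)
Lemma product_weight_resample (A : finType) (mu : A -> R) (K : pred A)
    (F : {ffun 'I_n -> A} -> R) : \sum_(a | K a) mu a != 0 ->
  \sum_w product_weight mu w * F w =
  \sum_w product_weight mu w *
    \sum_w' product_weight (cond_weight mu K) w' * F (mix K w w').
Proof.
move=> m0.
rewrite -(@product_weight_map _ _ (fun ab : A * A => mu ab.1 * cond_weight mu K ab.2)
  mu (fun ab => if K ab.1 then ab.2 else ab.1)) => [|c].
  rewrite (reindex (fun ww : {ffun 'I_n -> A} * {ffun 'I_n -> A} =>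
    [ffun i => (ww.1 i, ww.2 i)])) /=; last first.
    exists (fun w => ([ffun i => (w i).1], [ffun i => (w i).2])) => [[w w'] _|w _].
      by congr pair; apply/ffunP => i; rewrite !ffunE.
    by apply/ffunP => i; rewrite !ffunE /=; case: (w i).
  under [RHS]eq_bigr do rewrite mulr_sumr.
  rewrite pair_bigA /=; apply: eq_bigr => -[w w'] _ /=; rewrite mulrA; congr (_ * F _).
    by rewrite /product_weight -big_split; apply: eq_bigr => i _; rewrite ffunE.
  by apply/ffunP => i; rewrite !ffunE.
rewrite (eq_bigl (fun ab : A * A => true && ((if K ab.1 then ab.2 else ab.1) == c))) //.
rewrite -(pair_big_dep predT (fun a b => (if K a then b else a) == c)
  (fun a b => mu a * cond_weight mu K b)) /=.
rewrite (bigID K) /=.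
have -> : \sum_(i | K i) \sum_(j | (if K i then j else i) == c) mu i * cond_weight mu K j =
    (\sum_(i | K i) mu i) * cond_weight mu K c.
  rewrite mulr_suml; apply: eq_bigr => i ->.
  by rewrite big_pred1_eq.
have -> : \sum_(i | ~~ K i) \sum_(j | (if K i then j else i) == c) mu i * cond_weight mu K j =
    if K c then 0 else mu c.
  rewrite (eq_bigr (fun i => if i == c then mu i else 0)); last first.
    move=> i /negbTE ->; case: eqP => [->|_]; last by rewrite big_pred0.
    rewrite -mulr_sumr (bigID K) /= [X in _ + X]big1 => [|j /negbTE Kj]; last first.
      by rewrite /cond_weight Kj.
    rewrite addr0 (eq_bigr (fun j => mu j / \sum_(b | K b) mu b)) => [|j Kj]; last first.
      by rewrite /cond_weight Kj.
    by rewrite -mulr_suml divff // mulr1.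
  rewrite -big_mkcondr /=; case: ifP => Kc.
    by apply: big_pred0 => i; case: eqP => [->|]; rewrite ?Kc ?andbF.
  rewrite (eq_bigl (pred1 c)) ?big_pred1_eq // => i /=.
  by case: eqP => [->|]; rewrite ?Kc ?andbF.
rewrite /cond_weight; case: ifP => _; last by rewrite mulr0 add0r.
by rewrite addr0 mulrC divfK.
Qed.

Lemma product_weight_ge0 (A : finType) (mu : A -> R) w :
  (forall a, 0 <= mu a) -> 0 <= product_weight mu w.
Proof. by move=> mu0; apply: prodr_ge0 => i _. Qed.

End product_weight.

Section finite_fibers.
Context (disp : measure_display) (T : measurableType disp) (R : realType).
Context (Q : probability T R) (F : finType) (X : T -> F).
Hypothesis mX : forall a, measurable (X @^-1` [set a]).

Let fibersE (E : pred F) :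
  [set w | E (X w)] = \bigcup_(a in [set a | E a]) (X @^-1` [set a]).
Proof.
apply/seteqP; split => [w Ew|w [a Ea /= ->//]].
by exists (X w).
Qed.

Lemma measurable_fibers (E : pred F) : measurable [set w | E (X w)].
Proof. by rewrite fibersE; apply: fin_bigcup_measurable => //; exact: finite_finset. Qed.

Lemma prob_fibers (E : pred F) :
  Q [set w | E (X w)] = (\sum_(a | E a) fine (Q (X @^-1` [set a])))%:E.
Proof.
rewrite fibersE measure_fin_bigcup //; last 2 first.
- exact: finite_finset.
- by move=> a b _ _ [w [/= <- <-]].
rewrite fsbig_finite /=; last exact: finite_finset.
rewrite -sumEFin -big_enum /= (perm_big (enum E)) /=.
  apply: eq_bigr => a _; rewrite fineK //; exact: fin_num_measure.
apply: uniq_perm; [exact: finmap.fset_uniq|exact: enum_uniq|move=> a].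
rewrite in_fset_set ?mem_enum; last exact: finite_finset.
by apply/idP/idP; rewrite inE.
Qed.

End finite_fibers.

Section codes.
Context (R : realType) (V : seq R).

(* A real is only seen through its comparisons with the thresholds in [V]. *)
Definition code (x : R) : {ffun 'I_(size V) -> bool} := [ffun j => V`_(j : 'I__) < x].
Definition decode (c : {ffun 'I_(size V) -> bool}) : R := xget 0 [set x | code x = c].

Lemma code_eq_lt x y v : code x = code y -> v \in V -> (v < x) = (v < y).
Proof.
move=> xy vV; have jV : (index v V < size V)%N by rewrite index_mem.
by have /ffunP/(_ (Ordinal jV)) := xy; rewrite !ffunE /= nth_index.
Qed.

Lemma decodeK x : code (decode (code x)) = code x.
Proof. by rewrite /decode; apply: (@xgetPex _ 0 [set y | code y = code x]); exists x. Qed.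

Lemma lt_decode x v : v \in V -> (v < decode (code x)) = (v < x).
Proof. by apply: code_eq_lt; exact: decodeK. Qed.

Lemma measurable_code c : measurable (code @^-1` [set c] : set R).
Proof.
have -> : code @^-1` [set c] = \big[setI/setT]_(j < size V)
    (if c j then [set` `]V`_j, +oo[] else [set` `]-oo, V`_j]]) :> set R.
  apply/seteqP; split => x.
    move=> /= <-; rewrite -bigcap_seq => j _ /=; rewrite ffunE.
    by case: ltP => h /=; rewrite in_itv /= ?h ?andbT.
  rewrite -bigcap_seq => h; apply/ffunP => j; rewrite ffunE.
  have := h j; rewrite /= mem_index_enum => /(_ isT).
  by case: (c j); rewrite /= in_itv /= ?andbT // => /le_gtF.
by apply: bigsetI_measurable => j _; case: (c j); exact: measurable_itv.
Qed.

Definition code_weight c : R := fine (uniform_prob (@ltr01 R) (code @^-1` [set c])).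

Lemma code_weight_ge0 c : 0 <= code_weight c.
Proof. by apply: fine_ge0; exact: measure_ge0. Qed.

Lemma uniform_prob_le (p : R) : 0 <= p <= 1 ->
  uniform_prob (@ltr01 R) [set x | x <= p] = p%:E.
Proof.
move=> /andP[p0 p1]; rewrite /uniform_prob integral_uniform_pdf.
have -> : [set x | x <= p] `&` [set` `[0, 1]] = [set` `[0, p]] :> set R.
  apply/seteqP; split => x /=; rewrite !in_itv /=.
    by move=> [-> /andP[-> _]].
  by move=> /andP[-> xp]; rewrite xp (le_trans xp).
rewrite (eq_integral (fun=> 1%:E)) => [|x]; last first.
  rewrite inE /= in_itv /= => /andP[x0 xp].
  by rewrite /uniform_pdf x0 (le_trans xp) //= subr0 invr1.
rewrite integral_cst //= lebesgue_measure_itv /= lte_fin mul1e.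
by case: ltP => [_|p0']; rewrite ?oppr0 ?addr0 ?sube0 //; congr EFin; apply/le_anti/andP.
Qed.

Lemma sum_code_weight_le p : p \in V -> 0 <= p <= 1 ->
  \sum_(c | decode c <= p) code_weight c = p.
Proof.
move=> pV p01.
have := prob_fibers (uniform_prob (@ltr01 R)) measurable_code (fun c => decode c <= p).
rewrite (_ : [set _ | _] = [set x | x <= p]); last first.
  by apply/seteqP; split => x /=; rewrite !leNgt lt_decode.
by move=> /(etrans (esym (uniform_prob_le p01)))[].
Qed.

End codes.

Section discretization.
Context (R : realType) (n : nat) (disp : measure_display) (T : measurableType disp)
  (P : probability T R) (sigma : {RV P >-> n.-tuple bool}) (tau : {RV P >-> n.-tuple R}).
Hypotheses (usigma : uniform_bits sigma) (utau : uniform_cube tau).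
Hypothesis (indep : independent_RV2 sigma tau).
Context (V : seq R).

Local Notation letter := (bool * {ffun 'I_(size V) -> bool})%type.
Local Notation word := {ffun 'I_n -> letter}.

Definition letter_weight (a : letter) : R := 1 / 2 * code_weight a.2.

Definition word_bits (w : word) : n.-tuple bool := [tuple (w i).1 | i < n].
Definition word_times (w : word) : n.-tuple R := [tuple decode (w i).2 | i < n].

Let X (t : T) : word := [ffun i => (tnth (sigma t) i, code V (tnth (tau t) i))].

Let cells (w : word) : set (n.-tuple R) :=
  [set x | forall i, (code V @^-1` [set (w i).2]) (tnth x i)].

Let fiberE w : X @^-1` [set w] = sigma @^-1` [set word_bits w] `&` tau @^-1` cells w.
Proof.
apply/seteqP; split => [t /= <-|t [/= sw tw]].
  split; first by apply: eq_from_tnth => i; rewrite tnth_mktuple ffunE.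
  by move=> i /=; rewrite ffunE.
apply/ffunP => i; rewrite ffunE sw tnth_mktuple.
by have := tw i; rewrite /= => ->; case: (w i).
Qed.

Let measurable_cells w : measurable (cells w).
Proof.
have -> : cells w = \big[setI/setT]_(i < n)
    ((fun x => tnth x i) @^-1` (code V @^-1` [set (w i).2])).
  apply/seteqP; split => x; rewrite -bigcap_seq.
    by move=> xw i _; exact: xw.
  by move=> xw i; apply: (xw i); rewrite /= mem_index_enum.
apply: bigsetI_measurable => i _.
rewrite -[X in measurable X]setTI; apply: measurable_tnth => //.
exact: measurable_code.
Qed.

Let measurable_bits (s : n.-tuple bool) : measurable [set s].
Proof.
have -> : [set s] = \big[setI/setT]_(i < n) ((fun x => tnth x i) @^-1` [set tnth s i]).
  apply/seteqP; split => x; rewrite -bigcap_seq; first by move=> -> i _.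
  by move=> xs; apply: eq_from_tnth => i; apply: (xs i); rewrite /= mem_index_enum.
apply: bigsetI_measurable => i _.
by rewrite -[X in measurable X]setTI; apply: measurable_tnth.
Qed.

Let measurable_fiber w : measurable (X @^-1` [set w]).
Proof.
by rewrite fiberE; apply: measurableI; apply: measurable_funPTI.
Qed.

Let prob_fiber w : P (X @^-1` [set w]) = (product_weight letter_weight w)%:E.
Proof.
rewrite fiberE indep // usigma.
have -> : tau @^-1` cells w =
    [set t | forall i, (code V @^-1` [set (w i).2]) (tnth (tau t) i)] by [].
rewrite (utau (B := fun i => code V @^-1` [set (w i).2])) => [|i]; last exact: measurable_code.
rewrite /product_weight /letter_weight big_split /= prodr_const card_ord.
rewrite div1r exprVn EFinM; congr (_ * _)%E; rewrite -prodEFin.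
by apply: eq_bigr => i _; rewrite fineK //; apply: fin_num_measure; exact: measurable_code.
Qed.

Definition code_determined (F : n.-tuple bool -> n.-tuple R -> bool) :=
  forall s t t', (forall i v, v \in V -> (v < tnth t i) = (v < tnth t' i)) ->
  F s t = F s t'.

Let discretizeE F : code_determined F ->
  [set t | F (sigma t) (tau t)] = [set t | F (word_bits (X t)) (word_times (X t))].
Proof.
move=> dF; suff E t : F (word_bits (X t)) (word_times (X t)) = F (sigma t) (tau t).
  by apply/seteqP; split => t /=; rewrite E.
have -> : word_bits (X t) = sigma t.
  by apply: eq_from_tnth => i; rewrite tnth_mktuple ffunE.
by apply: dF => i v vV; rewrite tnth_mktuple ffunE /= lt_decode.
Qed.

Lemma measurable_discretize F : code_determined F ->
  measurable [set t | F (sigma t) (tau t)].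
Proof.
move=> dF; rewrite discretizeE //.
exact: (measurable_fibers measurable_fiber (fun w => F (word_bits w) (word_times w))).
Qed.

Lemma prob_discretize F : code_determined F ->
  P [set t | F (sigma t) (tau t)] =
  (\sum_w product_weight letter_weight w * (F (word_bits w) (word_times w))%:R)%:E.
Proof.
move=> dF; rewrite discretizeE //.
rewrite (prob_fibers P measurable_fiber (fun w => F (word_bits w) (word_times w))).
congr EFin; rewrite big_mkcond; apply: eq_bigr => w _.
by rewrite prob_fiber /=; case: ifP => _; rewrite ?mulr1 ?mulr0.
Qed.

End discretization.

(** * Switching conditionally on [q] *)

HB.instance Definition _ (n : nat) := gen_eqMixin (formula n).
HB.instance Definition _ (n : nat) := gen_choiceMixin (formula n).

Lemma formula_nested_ind n (Q : formula n -> Prop) :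
  (forall i b, Q (Lit i b)) ->
  (forall g Psi Psis, (forall F, F \in Psi :: Psis -> Q F) -> Q (Gate g Psi Psis)) ->
  forall F, Q F.
Proof.
move=> QL QG.
have {}QG g Psi Psis : Q Psi -> foldr (fun F => and (Q F)) True Psis -> Q (Gate g Psi Psis).
  move=> QPsi QPsis; apply: QG => F; rewrite inE => /orP[/eqP -> //|].
  elim: Psis QPsis => //= G Psis IH [QG QPsis]; rewrite inE => /orP[/eqP -> //|].
  exact: IH.
fix IH 1 => -[i b|g Psi Psis]; first exact: QL.
apply: (QG g _ _ (IH Psi)).
elim: Psis => [|G Psis IHs] /=; first exact: I.
by split; [exact: IH|exact: IHs].
Qed.

Lemma foldr_min_le (R : realDomainType) (x : R) s y :
  y \in x :: s -> foldr Num.min x s <= y.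
Proof.
elim: s => [|z s IH] /=; first by rewrite inE => /eqP ->.
rewrite !inE ge_min => /or3P[/eqP yx|/eqP ->|ys]; rewrite ?lexx //.
  by rewrite IH ?orbT // inE yx eqxx.
by rewrite IH ?orbT // inE ys orbT.
Qed.

Lemma foldr_min_mem (R : realDomainType) (x : R) s : foldr Num.min x s \in x :: s.
Proof.
elim: s => [|z s IH] /=; first by rewrite mem_head.
rewrite minEle; case: ifP => _; first by rewrite !inE eqxx orbT.
by move: IH; rewrite !inE => /orP[->//|->]; rewrite !orbT.
Qed.

Section formulas.
Context (n : nat).
Implicit Types (F : formula n) (g : gate).

Lemma depth_child g Psi Psis F : F \in Psi :: Psis ->
  (depth_formula F < depth_formula (Gate g Psi Psis))%N.
Proof.
rewrite /= ltnS; elim: Psis => [|G Psis IH] /=; first by rewrite inE => /eqP ->.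
rewrite leq_max !inE => /or3P[/eqP FP|/eqP ->|FP]; rewrite ?leqnn //.
  by rewrite IH ?orbT // inE FP eqxx.
by rewrite IH ?orbT // inE FP orbT.
Qed.

Lemma size_children g (Psi : formula n) Psis :
  (\sum_(F <- Psi :: Psis) size_formula F <= size_formula (Gate g Psi Psis))%N.
Proof.
by rewrite big_cons /= sumnE big_map leqnSn.
Qed.

Definition is_gate F := if F is Gate _ _ _ then true else false.

Lemma Ddepth_literal i b (r : restriction n) :
  (Ddepth (restrict (eval_formula (Lit i b)) r) <= 1)%N.
Proof.
apply: leq_trans (Ddepth_restrict _ _) _.
apply: (@Ddepth_le _ _ (DNode i (DLeaf n (~~ b)) (DLeaf n b))) => x /=.
by case: (tnth x i); case: b.
Qed.

Definition is_and g := if g is AND then true else false.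

Lemma eval_gate_or g (Psi : formula n) Psis (r : restriction n) :
  let h F x := is_and g (+) restrict (eval_formula F) r x in
  restrict (eval_formula (Gate g Psi Psis)) r =
  fun x => is_and g (+) has (fun f : boolfun n => f x) [seq h F | F <- Psi :: Psis].
Proof.
move=> h; apply/funext => x; rewrite has_map /h /restrict.
case: g {h} => /=; last by [].
by rewrite negb_or negbK; congr (_ && _); rewrite -all_predC; apply: eq_all => F /=; rewrite negbK.
Qed.

End formulas.

Section qval_theory.
Context (R : realType) (n : nat).
Implicit Types (s : n.-tuple bool) (t : n.-tuple R) (F : formula n) (g : gate).

Definition pval s t Psi (Psis : seq (formula n)) : R :=
  foldr Num.min (qval s t Psi) [seq qval s t F | F <- Psis].

Lemma qval_gate s t g Psi Psis :
  let p := pval s t Psi Psis in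
  qval s t (Gate g Psi Psis) = p / (14 * (kval s t (Psi :: Psis) p)%:R).
Proof. by []. Qed.

Lemma pval_le s t Psi Psis F : F \in Psi :: Psis -> pval s t Psi Psis <= qval s t F.
Proof.
by move=> FP; apply: foldr_min_le; rewrite -map_cons; exact: map_f.
Qed.

Lemma pval_ex s t Psi Psis :
  exists2 F, F \in Psi :: Psis & pval s t Psi Psis = qval s t F.
Proof.
have := foldr_min_mem (qval s t Psi) [seq qval s t F | F <- Psis].
by rewrite -(map_cons (qval s t)) => /mapP[F FP E]; exists F.
Qed.

Lemma kval_ge1 s t Psis p : (1 <= kval s t Psis p)%N.
Proof. by rewrite leq_maxl. Qed.

Lemma kval_ge s t Psis p F : F \in Psis ->
  (Ddepth (restrict (eval_formula F) (Rst s t p)) <= kval s t Psis p)%N.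
Proof. by move=> FP; rewrite leq_max (leq_bigmax_seq F) ?orbT. Qed.

Lemma kval_ex s t Psis p : (1 < kval s t Psis p)%N ->
  exists2 F, F \in Psis & Ddepth (restrict (eval_formula F) (Rst s t p)) = kval s t Psis p.
Proof.
rewrite /kval; set k := \max_(F <- Psis) _ => k1.
have -> : maxn 1 k = k by move: k1; lia.
have {k1} : (0 < k)%N by move: k1; lia.
rewrite /k {k}; elim: Psis => [|F Psis IH]; first by rewrite big_nil.
rewrite big_cons; case: (leqP (Ddepth _)) => [_ /IH[G GP E]|_ _].
  by exists G => //; rewrite inE GP orbT.
by exists F => //; rewrite mem_head.
Qed.

Lemma kval_le s t Psis p : (kval s t Psis p <= n.+1)%N.
Proof.
rewrite geq_max /=; apply/bigmax_leqP_seq => F _ _.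
exact: leq_trans (Ddepth_leq_dim _) (leqnSn _).
Qed.

Lemma qval_gt0 s t F : 0 < qval s t F.
Proof.
elim/formula_nested_ind: F => [//|g Psi Psis IH]; rewrite qval_gate /=.
have [F FP ->] := pval_ex s t Psi Psis.
by rewrite divr_gt0 ?IH // mulr_gt0 // ltr0n; exact: kval_ge1.
Qed.

Lemma pval_gt0 s t Psi Psis : 0 < pval s t Psi Psis.
Proof. by have [F FP ->] := pval_ex s t Psi Psis; exact: qval_gt0. Qed.

Lemma qval_le_pval s t g Psi Psis : qval s t (Gate g Psi Psis) <= pval s t Psi Psis.
Proof.
rewrite qval_gate /=; set p := pval _ _ _ _; set k := kval _ _ _ _.
have k1 : 1 <= k%:R :> R by rewrite ler1n kval_ge1.
have p0 : 0 < p by exact: pval_gt0.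
rewrite ler_pdivrMr; last by lra.
by rewrite ler_peMr ?ltW //; lra.
Qed.

Lemma qval_le1 s t F : qval s t F <= 1.
Proof.
elim/formula_nested_ind: F => [//|g Psi Psis IH].
apply: le_trans (qval_le_pval _ _ _ _ _) _.
by apply: le_trans (pval_le _ _ (mem_head _ _)) _; exact: IH (mem_head _ _).
Qed.

Lemma Rst_le s t p q i b : q <= p -> Rst s t p i = Some b -> Rst s t q i = Some b.
Proof. by rewrite /Rst => qp; case: ifP => // /(le_lt_trans qp) ->. Qed.

Fixpoint qgrid d : seq R :=
  if d is d'.+1 then
    qgrid d' ++ [seq p / (14 * k%:R) | p <- qgrid d', k <- iota 1 n.+1]
  else [:: 1].

Lemma qgrid_le d d' : (d <= d')%N -> {subset qgrid d <= qgrid d'}.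
Proof.
elim: d' => [|d' IH]; first by rewrite leqn0 => /eqP ->.
rewrite leq_eqVlt => /predU1P[-> //|]; rewrite ltnS => /IH dd' v /dd' vd'.
by rewrite /= mem_cat vd'.
Qed.

Lemma qgrid_01 d v : v \in qgrid d -> 0 < v <= 1.
Proof.
elim: d v => [|d IH] v; first by rewrite inE => /eqP ->; rewrite ltr01 lexx.
rewrite mem_cat => /orP[/IH//|/allpairsP[[p k] [/IH/andP[p0 p1]]]].
rewrite mem_iota => /andP[k1 _] -> /=; move: p0 p1 => /= p0 p1.
have {}k1 : 1 <= k%:R :> R by rewrite ler1n.
by rewrite divr_gt0 /= ?ler_pdivrMr; lra.
Qed.

Lemma qval_grid s t F d : (depth_formula F <= d)%N -> qval s t F \in qgrid d.
Proof.
elim/formula_nested_ind: F d => [i b|g Psi Psis IH] d Fd.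
  by apply: (qgrid_le (leq0n d)); rewrite inE.
case: d Fd => [//|d] Fd; rewrite qval_gate mem_cat; apply/orP; right.
apply/allpairsP; exists (pval s t Psi Psis, kval s t (Psi :: Psis) (pval s t Psi Psis)).
split => //; last first.
  by rewrite mem_iota; apply/andP; split; [exact: kval_ge1|rewrite add1n ltnS; exact: kval_le].
rewrite -/qgrid /=.
have [F FP ->] := pval_ex s t Psi Psis; apply: IH => //.
by rewrite -ltnS; apply: leq_trans (depth_child g FP) Fd.
Qed.

Lemma pval_grid s t g Psi Psis d : (depth_formula (Gate g Psi Psis) <= d)%N ->
  pval s t Psi Psis \in qgrid d.
Proof.
have [F FP ->] := pval_ex s t Psi Psis => Fd; apply: qval_grid.
by apply: ltnW; apply: leq_trans (depth_child g FP) Fd.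
Qed.

Lemma eq_pval s t s' t' Psi Psis :
  (forall F, F \in Psi :: Psis -> qval s t F = qval s' t' F) ->
  pval s t Psi Psis = pval s' t' Psi Psis.
Proof.
move=> E; rewrite /pval E ?mem_head //; congr foldr.
by apply/eq_in_map => F FP; apply: E; rewrite inE FP orbT.
Qed.

Lemma eq_kval s t s' t' Psis p : Rst s t p = Rst s' t' p ->
  kval s t Psis p = kval s' t' Psis p.
Proof. by rewrite /kval => ->. Qed.

Lemma eq_qval s t s' t' g Psi Psis :
  pval s t Psi Psis = pval s' t' Psi Psis ->
  Rst s t (pval s t Psi Psis) = Rst s' t' (pval s t Psi Psis) ->
  qval s t (Gate g Psi Psis) = qval s' t' (Gate g Psi Psis).
Proof. by rewrite !qval_gate /= => <- /eq_kval ->. Qed.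

Lemma qval_code s t t' F d : (depth_formula F <= d)%N ->
  (forall p, p \in qgrid d -> Rst s t p = Rst s t' p) -> qval s t F = qval s t' F.
Proof.
move=> + E; elim/formula_nested_ind: F => [//|g Psi Psis IH] Fd.
apply: eq_qval; last by apply: E; exact: pval_grid Fd.
apply: eq_pval => F FP; apply: IH => //.
by apply: ltnW; apply: leq_trans (depth_child g FP) Fd.
Qed.

(* [qval] only looks at the restrictions [Rst p] with [p] at least its own value. *)
Lemma qval_above s t s' t' p0 F :
  (forall p, p0 <= p -> Rst s t p = Rst s' t' p) -> p0 <= qval s t F ->
  qval s t F = qval s' t' F.
Proof.
move=> E; elim/formula_nested_ind: F => [//|g Psi Psis IH] qp.
have pp : p0 <= pval s t Psi Psis by apply: le_trans qp (qval_le_pval _ _ _ _ _).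
apply: eq_qval; last exact: E.
by apply: eq_pval => F FP; apply: IH => //; apply: le_trans pp (pval_le _ _ FP).
Qed.

Lemma pval_above s t s' t' p0 Psi Psis :
  (forall p, p0 <= p -> Rst s t p = Rst s' t' p) -> p0 <= pval s t Psi Psis ->
  pval s t Psi Psis = pval s' t' Psi Psis.
Proof.
move=> E pp; apply: eq_pval => F FP; apply: (qval_above E).
exact: le_trans pp (pval_le _ _ FP).
Qed.

End qval_theory.

Section conditional_switching.
Context (R : realType) (n : nat) (g : gate) (Psi : formula n) (Psis : seq (formula n)).
Context (a x : R) (m : nat).
Hypothesis a01 : 0 < a <= 1.

Local Notation Phi := (Gate g Psi Psis).
Local Notation d := (depth_formula Phi).

Definition thresholds : seq R := qgrid R n d ++ [seq a * v | v <- qgrid R n d].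
Local Notation V := thresholds.

Local Notation letter := (bool * {ffun 'I_(size V) -> bool})%type.
Local Notation word := {ffun 'I_n -> letter}.
Local Notation wq w := (qval (word_bits w) (word_times w) Phi).
Local Notation wp w := (pval (word_bits w) (word_times w) Psi Psis).
Local Notation wR w := (Rst (word_bits w) (word_times w)).
Implicit Types (s : n.-tuple bool) (t : n.-tuple R).

Definition small_q s t := qval s t Phi <= x.
Definition deep_q s t :=
  (m <= Ddepth (restrict (eval_formula Phi) (Rst s t (a * qval s t Phi))))%N.
Local Notation wsmall w := (small_q (word_bits w) (word_times w)).
Local Notation wdeep w := (deep_q (word_bits w) (word_times w)).

Let a0 : 0 < a. Proof. by case/andP: a01. Qed.
Let a1 : a <= 1. Proof. by case/andP: a01. Qed.

Let V01 v : v \in V -> 0 <= v <= 1.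
Proof.
rewrite mem_cat => /orP[/qgrid_01/andP[v0 ->]|/mapP[u /qgrid_01/andP[u0 u1] ->]].
  by rewrite ltW.
by rewrite (mulr_ge0 (ltW a0) (ltW u0)) (mulr_ile1 (ltW a0) (ltW u0)).
Qed.

Let Rst_code s t t' p :
  (forall i v, v \in V -> (v < tnth t i) = (v < tnth t' i)) -> p \in V ->
  Rst s t p = Rst s t' p.
Proof. by move=> E pV; apply/funext => i; rewrite /Rst E. Qed.

Let qval_det s t t' :
  (forall i v, v \in V -> (v < tnth t i) = (v < tnth t' i)) ->
  qval s t Phi = qval s t' Phi.
Proof.
move=> E; apply: (@qval_code _ _ _ _ _ _ d) => // p pd.
by apply: Rst_code => //; rewrite mem_cat pd.
Qed.

Let small_determined : code_determined V small_q.
Proof. by move=> s t t' E; rewrite /small_q (qval_det _ E). Qed.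

Let deep_determined : code_determined V (fun s t => small_q s t && deep_q s t).
Proof.
move=> s t t' E; rewrite /small_q /deep_q (qval_det _ E) (Rst_code _ E) //.
rewrite mem_cat; apply/orP; right; apply: map_f; exact: qval_grid.
Qed.

Definition low (p0 : R) (b : letter) := decode b.2 <= p0.

Let sum_letter (b : option bool) (p : R) : p \in V ->
  \sum_(l : letter | (decode l.2 <= p) && (if b is Some c then l.1 == c else true))
    letter_weight l = if b is Some _ then p / 2 else p.
Proof.
move=> pV.
rewrite (eq_bigl (fun l : letter => (if b is Some c then l.1 == c else true) && (decode l.2 <= p)));
  last by move=> l; rewrite andbC.
rewrite -(pair_big (fun c' => if b is Some c then c' == c else true)
  (fun c => decode c <= p) (fun c' (c : {ffun 'I_(size V) -> bool}) => letter_weight (c', c))) /=.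
have E (c' : bool) :
    \sum_(c : {ffun 'I_(size V) -> bool} | decode c <= p) letter_weight (c', c) = p / 2.
  rewrite /letter_weight /= -mulr_sumr (sum_code_weight_le pV) ?V01 //.
  by rewrite div1r mulrC.
rewrite (eq_bigr _ (fun c' _ => E c')); case: b => [c|].
  by rewrite big_pred1_eq.
by rewrite big_mkcond big_bool /=; field.
Qed.

Let sum_low p : p \in V -> \sum_(l | low p l) letter_weight l = p.
Proof.
move=> pV; rewrite -[RHS](sum_letter None pV).
by apply: eq_bigl => l; rewrite andbT.
Qed.

Let mix_above p0 (w w' : word) : (forall i, low p0 (w' i)) ->
  forall p, p0 <= p -> wR (mix (low p0) w w') p = wR w p.
Proof.
move=> lw p pp; apply/funext => i; rewrite /Rst !tnth_mktuple ffunE.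
have [lo|//] := boolP (low p0 (w i)).
by rewrite !ltNge (le_trans lo pp) (le_trans (lw i) pp).
Qed.

Definition star_of (q : R) (l : letter) : option bool :=
  if q < decode l.2 then Some l.1 else None.

Let sum_star p0 q b : p0 \in V -> q \in V -> 0 < p0 -> q <= p0 ->
  \sum_(l | star_of q l == b) cond_weight (@letter_weight R V) (low p0) l =
  star_weight (q / p0) b.
Proof.
move=> p0V qV p00 qp0.
have nz : p0 != 0 by rewrite gt_eqF.
have -> : \sum_(l | star_of q l == b) cond_weight (@letter_weight R V) (low p0) l =
    (\sum_(l | low p0 l && (star_of q l == b)) letter_weight l) / p0.
  rewrite mulr_suml big_mkcondl /=; apply: eq_bigr => l _.
  by rewrite /cond_weight (sum_low p0V); case: ifP.
case: b => [b|] /=.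
  have := sum_letter (Some b) p0V; rewrite (bigID (fun l : letter => q < decode l.2)) /=.
  rewrite [X in _ + X](eq_bigl (fun l : letter => (decode l.2 <= q) && (l.1 == b))); last first.
    move=> l; rewrite -leNgt andbC; case: leP => //= lq; rewrite ?andbF //.
    by rewrite (le_trans lq qp0).
  rewrite (sum_letter (Some b) qV) => /(canRL (addrK _)) E.
  rewrite (eq_bigl (fun l : letter => (decode l.2 <= p0) && (l.1 == b) && (q < decode l.2))).
    by rewrite E; field.
  move=> l; rewrite /low /star_of -andbA; congr (_ && _).
  by case: ltP; rewrite ?andbT ?andbF.
congr (_ / _); rewrite -[RHS](sum_letter None qV); apply: eq_bigl => l.
rewrite /low /star_of andbT [RHS]leNgt; case: ltP => //= lq; rewrite ?andbF //.
by rewrite (le_trans lq qp0).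
Qed.

Let letter_weight_ge0 (l : letter) : 0 <= letter_weight l.
Proof. by rewrite mulr_ge0 // code_weight_ge0. Qed.

Let resampled_bound p0 (w : word) : p0 \in qgrid R n d ->
  \sum_w' product_weight (cond_weight (@letter_weight R V) (low p0)) w' *
    [&& wp (mix (low p0) w w') == p0, wsmall (mix (low p0) w w') &
      wdeep (mix (low p0) w w')]%:R <=
  (a / expR 1) ^+ m * ((wp w == p0) && wsmall w)%:R.
Proof.
move=> p0d.
have p0V : p0 \in V by rewrite mem_cat p0d.
have p00 : 0 < p0 by case/andP: (qgrid_01 p0d).
set k := kval (word_bits w) (word_times w) (Psi :: Psis) p0.
have k1 : 1 <= k%:R :> R by rewrite ler1n kval_ge1.
have k0 : 0 < k%:R :> R by apply: lt_le_trans k1.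
set q := a * (p0 / (14 * k%:R)).
have qp : q / p0 = a / (14 * k%:R) by rewrite /q; field; rewrite !gt_eqF.
have qp0 : q <= p0.
  rewrite -[leRHS]mul1r -ler_pdivrMr // qp ler_pdivrMr ?mulr_gt0 //.
  by apply: le_trans a1 _; rewrite mul1r; lra.
pose star (w' : word) : {ffun 'I_n -> option bool} := [ffun i => star_of q (w' i)].
pose f := restrict (eval_formula Phi) (wR w p0).
have supp (w' : word) : product_weight (cond_weight (@letter_weight R V) (low p0)) w' != 0 ->
    forall i, low p0 (w' i).
  move=> /prodf_neq0 h i; have := h i isT; rewrite /cond_weight.
  by case: ifP => //; rewrite eqxx.
have E (w' : word) : (forall i, low p0 (w' i)) ->
    [&& wp (mix (low p0) w w') == p0, wsmall (mix (low p0) w w') &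
      wdeep (mix (low p0) w w')] =
    [&& wp w == p0, wsmall w & (m <= Ddepth (restrict f (star w')))%N].
  move=> lw; have ab := mix_above w lw.
  have pE : (wp (mix (low p0) w w') == p0) = (wp w == p0).
    apply/eqP/eqP => pE.
      by rewrite -pE; apply/esym; apply: (pval_above ab); rewrite pE.
    rewrite -[RHS]pE; apply/esym; apply: (@pval_above _ _ _ _ _ _ p0) => [p pp|].
      by rewrite ab.
    by rewrite pE.
  rewrite pE; have [pw|//] := eqVneq (wp w) p0; rewrite /=.
  have pm : wp (mix (low p0) w w') = p0 by apply/eqP; rewrite pE pw.
  have qE : wq (mix (low p0) w w') = wq w.
    by apply: eq_qval; rewrite pm ?pw // ab.
  rewrite /small_q /deep_q qE; congr (_ && _).
  have -> : a * wq w = q by rewrite qval_gate /= pw.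
  congr (m <= Ddepth _)%N; rewrite /f restrict_override; congr restrict.
  apply/funext => i; rewrite /override /Rst !tnth_mktuple !ffunE /low /star_of.
  case: (ltP p0) => [h|h] //.
  by rewrite (le_lt_trans qp0 h).
have -> : \sum_w' product_weight (cond_weight (@letter_weight R V) (low p0)) w' *
    [&& wp (mix (low p0) w w') == p0, wsmall (mix (low p0) w w') &
      wdeep (mix (low p0) w w')]%:R =
    ((wp w == p0) && wsmall w)%:R *
    \sum_w' product_weight (cond_weight (@letter_weight R V) (low p0)) w' *
      (m <= Ddepth (restrict f (star w')))%:R.
  rewrite mulr_sumr; apply: eq_bigr => w' _.
  have [->|/supp lw] := eqVneq (product_weight
    (cond_weight (@letter_weight R V) (low p0)) w') 0.
    by rewrite !mul0r mulr0.
  by rewrite E // andbA mulrCA -natrM mulnb.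
have [/andP[/eqP pE _]|_] := boolP ((wp w == p0) && wsmall w); last first.
  by rewrite mul0r mulr0.
rewrite mul1r mulr1.
have qV : q \in V.
  rewrite mem_cat; apply/orP; right; apply: map_f.
  have <- : wq w = p0 / (14 * k%:R) by rewrite qval_gate /= pE.
  exact: qval_grid.
rewrite (product_weight_map (fun rho => (m <= Ddepth (restrict f rho))%:R)
  (fun b => sum_star b p0V qV p00 qp0)) qp /f eval_gate_or.
apply: switching_gate => //; first exact: kval_ge1.
rewrite all_map; apply/allP => F FP /=.
have := kval_ge (word_bits w) (word_times w) p0 FP.
by case: (g) => //=; rewrite Ddepth_negb.
Qed.

Context (disp : measure_display) (T : measurableType disp) (P : probability T R).
Context (sigma : {RV P >-> n.-tuple bool}) (tau : {RV P >-> n.-tuple R}).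
Hypotheses (usigma : uniform_bits sigma) (utau : uniform_cube tau).
Hypothesis (indep : independent_RV2 sigma tau).

Lemma measurable_small_q : measurable [set t | small_q (sigma t) (tau t)].
Proof. exact: measurable_discretize small_determined. Qed.

Lemma measurable_deep_q :
  measurable [set t | small_q (sigma t) (tau t) && deep_q (sigma t) (tau t)].
Proof. exact: measurable_discretize deep_determined. Qed.

Lemma conditional_switching :
  (P [set t | small_q (sigma t) (tau t) && deep_q (sigma t) (tau t)] <=
   ((a / expR 1) ^+ m)%:E * P [set t | small_q (sigma t) (tau t)])%E.
Proof.
rewrite (prob_discretize usigma utau indep small_determined).
rewrite (prob_discretize usigma utau indep deep_determined).
rewrite -EFinM lee_fin.
set G := undup (qgrid R n d).
have split_p (B : word -> bool) :
    \sum_w product_weight (@letter_weight R V) w * (B w)%:R =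
    \sum_(p0 <- G) \sum_w product_weight (@letter_weight R V) w * ((wp w == p0) && B w)%:R.
  rewrite exchange_big; apply: eq_bigr => w _; rewrite -mulr_sumr; congr (_ * _).
  rewrite (bigD1_seq (wp w)) ?undup_uniq //=; last by rewrite mem_undup (pval_grid _ _ (g := g)).
  rewrite eqxx /= big1 ?addr0 // => p0 /negbTE; rewrite eq_sym => -> //.
rewrite (split_p (fun w => wsmall w && wdeep w)) (split_p (fun w => wsmall w)).
rewrite mulr_sumr big_seq [leRHS]big_seq; apply: ler_sum => p0; rewrite mem_undup => p0d.
have p0V : p0 \in V by rewrite mem_cat p0d.
rewrite (product_weight_resample (K := low p0)
  (fun w => ((wp w == p0) && (wsmall w && wdeep w))%:R)); last first.
  by rewrite sum_low // gt_eqF //; case/andP: (qgrid_01 p0d).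
rewrite mulr_sumr; apply: ler_sum => w _; rewrite mulrCA; apply: ler_wpM2l.
  exact: product_weight_ge0.
exact: resampled_bound.
Qed.

End conditional_switching.

(** * Tail of [q] *)

Lemma prob_subset_union (R : realType) (disp : measure_display) (T : measurableType disp)
    (P : probability T R) (I : choiceType) (s : seq I) (A : I -> set T) (r : I -> R) (E : set T) :
  measurable E -> (forall i, i \in s -> measurable (A i)) ->
  (forall i, i \in s -> (P (A i) <= (r i)%:E)%E) ->
  (forall t, E t -> exists2 i, i \in s & A i t) ->
  (P E <= (\sum_(i <- s) r i)%:E)%E.
Proof.
move=> mE mA PA EA.
have mU s' : {subset s' <= s} -> measurable (\big[setU/set0]_(i <- s') A i).
  by move=> s's; rewrite big_seq; apply: bigsetU_measurable => i /s's; exact: mA.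
apply: (@le_trans _ _ (P (\big[setU/set0]_(i <- s) A i))).
  apply: le_measure; rewrite ?inE //; first exact: mU.
  by move=> t /EA[i si Ai]; rewrite -bigcup_seq; exists i.
have : {subset s <= s} by [].
elim: {-2}s => [|i s' IH] s's; first by rewrite !big_nil measure0.
rewrite !big_cons EFinD.
have iin : i \in s by apply: s's; rewrite mem_head.
have {}s's : {subset s' <= s} by move=> j js; apply: s's; rewrite inE js orbT.
apply: (le_trans (measureU2 P (mA _ iin) (mU _ s's))).
by apply: leeD; [exact: PA|exact: IH].
Qed.

Lemma natr_ceil (R : archiFieldType) (y : R) :
  exists2 M : nat, y <= M%:R & forall k : nat, y <= k%:R -> (M <= k)%N.
Proof.
have ex : exists M : nat, y <= M%:R.
  exists (Num.bound `|y|); apply: le_trans (ler_norm _) _; apply: ltW.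
  exact: archi_boundP.
by case: (ex_minnP ex) => M yM Mmin; exists M.
Qed.

Section tail_terms.
Context (R : realType).

Definition tail_term0 (i : nat) : R :=
  (expR (expR (i%:R - 1) - i.+1%:R * expR (- 2)))^-1.
Definition tail_term (i j : nat) : R :=
  (expR (j.+1%:R * expR (i%:R - 1) - (i + j + 2)%N%:R * expR (- 2)))^-1.

Lemma tail_exponent_ge0 (i j : nat) :
  0 <= j.+1%:R * expR (i%:R - 1) - (i + j + 2)%N%:R * expR (- 2) :> R.
Proof.
have -> : i%:R - 1 = i.+1%:R + - 2 :> R by rewrite -natr1; ring.
rewrite expRD mulrA -mulrBl mulr_ge0 ?expR_ge0 // subr_ge0.
apply: (@le_trans _ _ (j.+1%:R * i.+2%:R)).
  by rewrite -natrM ler_nat; nia.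
by apply: ler_wpM2l => //; apply: le_trans (expR_ge1Dx _); rewrite addrC natr1.
Qed.

Lemma tail_exponent0_ge0 (i : nat) :
  0 <= expR (i%:R - 1) - i.+1%:R * expR (- 2) :> R.
Proof.
have := tail_exponent_ge0 i 0; rewrite mul1r addn0; set e := expR _; set e2 := expR _.
have : 0 <= e2 by exact: expR_ge0.
have -> : (i + 2)%N%:R = i.+1%:R + 1 :> R by rewrite natr1; congr (_%:R); lia.
by rewrite mulrDl mul1r; lra.
Qed.

(* With [lam >= 1] the exponents of the constant are scaled up by [lam]. *)
Lemma tail_term_scale (i j : nat) (lam D : R) : 1 <= lam ->
  expR (- (j.+1%:R * (lam * expR (i%:R - 1)))) *
    expR (- (expR (- 2) * lam * (D - (i + j + 1)%N%:R))) <=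
  tail_term i j * expR (- (expR (- 2) * lam * (D + 1))).
Proof.
move=> lam1; rewrite /tail_term -expRN -!expRD ler_expR.
have := tail_exponent_ge0 i j; set e := expR _; set e2 := expR (- 2).
have -> : (i + j + 2)%N%:R = (i + j + 1)%N%:R + 1 :> R by rewrite natr1; congr (_%:R); lia.
set X := j.+1%:R * e; set m := (i + j + 1)%N%:R; rewrite (mulrCA _ lam) -/X.
by nra.
Qed.

Lemma tail_term0_scale (i : nat) (lam D : R) : 1 <= lam ->
  expR (- (lam * expR (i%:R - 1))) *
    expR (- (expR (- 2) * lam * (D - i%:R))) <=
  tail_term0 i * expR (- (expR (- 2) * lam * (D + 1))).
Proof.
move=> lam1; rewrite /tail_term0 -expRN -!expRD ler_expR.
have := tail_exponent0_ge0 i; set e := expR _; set e2 := expR (- 2).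
by rewrite -natr1; nra.
Qed.

End tail_terms.

Section tail_bound.
Context (R : realType) (C : R).
Hypothesis C_partial : forall N,
  1 + \sum_(i < N) (tail_term0 R i + \sum_(j < N) tail_term R i j) <= C.
Hypothesis C_expR1 : expR 1 <= C.
Context (n : nat) (disp : measure_display) (T : measurableType disp) (P : probability T R).
Context (sigma : {RV P >-> n.-tuple bool}) (tau : {RV P >-> n.-tuple R}).
Hypotheses (usigma : uniform_bits sigma) (utau : uniform_cube tau).
Hypothesis (indep : independent_RV2 sigma tau).
Implicit Types (F : formula n).

Local Notation q F t := (qval (sigma t) (tau t) F).
Local Notation D F t p := (Ddepth (restrict (eval_formula F) (Rst (sigma t) (tau t) p))).

Definition small_event F (x : R) : set T := [set t | q F t <= x].
Definition deep_event F (x a : R) (m : nat) : set T :=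
  [set t | (q F t <= x) && (m <= D F t (a * q F t))%N].

Lemma measurable_small_event F x : is_gate F -> measurable (small_event F x).
Proof.
case: F => // g Psi Psis _.
exact: (@measurable_small_q R n g Psi Psis 1 x disp T P sigma tau).
Qed.

Lemma measurable_deep_event F x a m : is_gate F -> 0 < a <= 1 ->
  measurable (deep_event F x a m).
Proof.
case: F => // g Psi Psis _ a01.
exact: (@measurable_deep_q R n g Psi Psis a x m disp T P sigma tau).
Qed.

Lemma deep_event_le F x m (j : nat) (y r : R) : is_gate F -> y <= m%:R ->
  (P (small_event F x) <= r%:E)%E ->
  (P (deep_event F x (expR (- j%:R)) m) <= (expR (- (j.+1%:R * y)) * r)%:E)%E.
Proof.
case: F => // g Psi Psis _ ym Pr.
have a01 : 0 < (expR (- j%:R) : R) <= 1 by rewrite expR_gt0 expR_le1 oppr_le0 ler0n.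
have := @conditional_switching R n g Psi Psis _ x m a01 disp T P sigma tau usigma utau indep.
move=> /le_trans; apply; rewrite EFinM; apply: lee_pmul => //.
rewrite lee_fin -expRB -expRM_natr ler_expR -opprD natr1 mulNr lerN2.
by apply: ler_wpM2l.
Qed.

Definition scale_bound (d : nat) := forall F (lam m : R), is_gate F ->
  (depth_formula F <= d.+1)%N -> 0 < lam ->
  (P (small_event F (expR m / (14 ^+ d.+1 * lam ^+ d))) <=
   ((size_formula F)%:R * C ^+ d * expR (- (expR (- 2) * lam * (d%:R - m))))%:E)%E.

Let C_ge0 : 0 <= C. Proof. by apply: le_trans C_expR1; exact: expR_ge0. Qed.

Lemma scale_bound0 : scale_bound 0.
Proof.
move=> [//|g Psi Psis] lam m _ Fd lam0; rewrite expr0 mulr1 expr1.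
have lit F : F \in Psi :: Psis -> is_gate F = false.
  move=> FP; have := leq_trans (depth_child g FP) Fd.
  by case: F {FP}.
have qE t : q (Gate g Psi Psis) t = 1 / 14.
  rewrite qval_gate /=.
  have -> : pval (sigma t) (tau t) Psi Psis = 1.
    by have [F /lit] := pval_ex (sigma t) (tau t) Psi Psis; case: F.
  suff -> : kval (sigma t) (tau t) (Psi :: Psis) 1 = 1%N by rewrite mulr1.
  apply/eqP; rewrite eqn_leq kval_ge1 andbT leqNgt; apply/negP => /[dup] k1 /kval_ex[F /lit].
  case: F => // i b _ E; move: k1; rewrite -E ltnNge => /negP; apply.
  exact: Ddepth_literal.
have [m0|m0] := ltP m 0.
  suff -> : small_event (Gate g Psi Psis) (expR m / 14) = set0.
    rewrite measure0 lee_fin; apply: mulr_ge0; rewrite ?expR_ge0 //.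
    by rewrite mulr_ge0 // exprn_ge0.
  apply/seteqP; split => // t; rewrite /small_event /= -/(q (Gate g Psi Psis) t) qE.
  by rewrite ler_pdivrMr // divfK // leNgt expR_lt1 m0.
apply: (@le_trans _ _ 1%E).
  by apply: probability_le1; exact: measurable_small_event.
rewrite lee_fin expr0 mulr1 -[leLHS]mulr1; apply: ler_pM => //.
  by rewrite ler1n.
rewrite -expR0 ler_expR sub0r mulrN opprK !mulr_ge0 // ?expR_ge0 //; exact: ltW.
Qed.

Lemma scale_bound_step d : scale_bound d -> forall F (lam : R), is_gate F ->
  (depth_formula F <= d.+2)%N -> 0 < lam ->
  (P (small_event F (1 / (14 ^+ d.+2 * lam ^+ d.+1))) <=
   ((size_formula F)%:R * C ^+ d.+1 * expR (- (expR (- 2) * lam * d.+1%:R)))%:E)%E.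
Proof.
move=> IH [//|g Psi Psis] lam _ Fd lam0; set Phi := Gate g Psi Psis.
set mE := measurable_small_event (1 / (14 ^+ d.+2 * lam ^+ d.+1)) (F := Phi) isT.
have [lame|lame] := leP lam (expR 1).
  apply: (@le_trans _ _ 1%E); first exact: probability_le1.
  rewrite lee_fin -mulrA -[leLHS]mulr1; apply: ler_pM => //; first by rewrite ler1n.
  rewrite -mulNr expRM_natr -exprMn; apply: exprn_ege1.
  rewrite expRN ler_pdivlMr ?expR_gt0 // mul1r; apply: le_trans C_expR1; rewrite ler_expR.
  apply: (@le_trans _ _ (expR (-2) * expR 1)); first by apply: ler_wpM2l; rewrite ?expR_ge0.
  by rewrite -expRD expR_le1; lra.
have lam1 : 1 <= lam by apply: ltW; apply: le_lt_trans lame; rewrite -expR0 ler_expR.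
set s := [seq F <- Psi :: Psis | is_gate F].
set U := 14 ^+ d.+1 * lam ^+ d.
have U1 : 1 <= U by rewrite /U -[leLHS]mulr1; apply: ler_pM => //; apply: exprn_ege1 => //; lra.
have U0 : 0 < U by apply: lt_le_trans U1.
have [N0 UN0] : exists N0 : nat, U < expR N0%:R.
  have [M UM _] := natr_ceil U; exists M; apply: le_lt_trans UM _.
  by apply: lt_le_trans (expR_ge1Dx _); lra.
set N := N0.+1.
have /choice[M MP] : forall i : nat, exists M : nat, lam * expR (i%:R - 1) <= M%:R /\
    forall k : nat, lam * expR (i%:R - 1) <= k%:R -> (M <= k)%N.
  by move=> i; have [M] := natr_ceil (lam * expR (i%:R - 1)); exists M.
set B := expR (- (expR (- 2) * lam * d.+1%:R)).
pose c F := (size_formula F)%:R * C ^+ d : R.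
have c0 F : 0 <= c F by rewrite /c mulr_ge0 // exprn_ge0.
pose x (m : R) := expR m / U.
pose Ei F i := deep_event F (x i%:R) (expR (- 0%:R)) (M i) `|`
  \big[setU/set0]_(j < N) deep_event F (x (i + j + 1)%N%:R) (expR (- j%:R)) (M i).
pose E F := small_event F (x (-1)) `|` \big[setU/set0]_(i < N) Ei F i.
have s_gate F : F \in s -> is_gate F /\ (depth_formula F <= d.+1)%N.
  rewrite mem_filter => /andP[Fg FP]; split => //.
  by rewrite -ltnS; apply: leq_trans (depth_child g FP) Fd.
have a01 (j : nat) : 0 < (expR (- j%:R) : R) <= 1.
  by rewrite expR_gt0 expR_le1 oppr_le0 ler0n.
have mEi F i : F \in s -> measurable (Ei F i).
  move=> /s_gate[Fg _]; apply: measurableU; first exact: measurable_deep_event.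
  by apply: bigsetU_measurable => j _; exact: measurable_deep_event.
have mEF F : F \in s -> measurable (E F).
  move=> Fs; apply: measurableU.
    by apply: measurable_small_event; case: (s_gate _ Fs).
  by apply: bigsetU_measurable => i _; exact: mEi.
have PEi F (i : nat) : F \in s ->
    (P (Ei F i) <= (c F * ((tail_term0 R i + \sum_(j < N) tail_term R i j) * B))%:E)%E.
  move=> Fs; have [Fg Fdd] := s_gate _ Fs.
  have := @prob_subset_union R disp T P (option 'I_N) (None :: [seq Some j | j <- index_enum 'I_N])
    (fun o => if o is Some j then
       deep_event F (x (i + (j : 'I_N) + 1)%N%:R) (expR (- (j : 'I_N)%:R)) (M i)
       else deep_event F (x i%:R) (expR (- 0%:R)) (M i))
    (fun o => c F * ((if o is Some j then tail_term R i (j : 'I_N) else tail_term0 R i) * B))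
    (Ei F i) (mEi _ _ Fs).
  rewrite big_cons big_map /= -!mulr_sumr -mulr_suml -mulrDr -mulrDl; apply.
  - by move=> [j|] _; exact: measurable_deep_event.
  - move=> [j|] _.
      apply: (le_trans (@deep_event_le F _ (M i) j _ _ Fg (MP i).1
        (IH F lam (i + j + 1)%N%:R Fg Fdd lam0))).
      rewrite lee_fin mulrCA; apply: ler_wpM2l; first exact: c0.
      by have := @tail_term_scale R i j lam d%:R lam1; rewrite natr1.
    apply: (le_trans (@deep_event_le F _ (M i) 0 _ _ Fg (MP i).1
      (IH F lam i%:R Fg Fdd lam0))).
    rewrite lee_fin mulrCA; apply: ler_wpM2l; first exact: c0.
    by have := @tail_term0_scale R i lam d%:R lam1; rewrite natr1 mul1r.
  - move=> t [Et|]; first by exists None => //; rewrite mem_head.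
    rewrite -bigcup_seq => -[j _ Et]; exists (Some j) => //.
    by rewrite inE /= map_f // mem_index_enum.
have PE F : F \in s -> (P (E F) <= (c F * (C * B))%:E)%E.
  move=> Fs; have [Fg Fdd] := s_gate _ Fs.
  have B0 : 0 <= B by exact: expR_ge0.
  have := @prob_subset_union R disp T P (option 'I_N) (None :: [seq Some j | j <- index_enum 'I_N])
    (fun o => if o is Some i then Ei F (i : 'I_N) else small_event F (x (-1)))
    (fun o => c F * ((if o is Some i then
       tail_term0 R (i : 'I_N) + \sum_(j < N) tail_term R i j else 1) * B))
    (E F) (mEF _ Fs).
  rewrite big_cons big_map /= -!mulr_sumr -mulr_suml -mulrDr -mulrDl => h.
  apply: (le_trans (h _ _ _)).
  - by move=> [j|] _; [exact: mEi|exact: measurable_small_event].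
  - move=> [j|] _; first exact: PEi.
    apply: le_trans (IH F lam _ Fg Fdd lam0) _.
    by rewrite lee_fin mul1r opprK natr1.
  - move=> t [Et|]; first by exists None => //; rewrite mem_head.
    rewrite -bigcup_seq => -[j _ Et]; exists (Some j) => //.
    by rewrite inE /= map_f // mem_index_enum.
  by rewrite lee_fin; apply: ler_wpM2l; [exact: c0|apply: ler_wpM2r; [exact: B0|exact: C_partial]].
have cover t : small_event Phi (1 / (14 ^+ d.+2 * lam ^+ d.+1)) t ->
    exists2 F, F \in s & E F t.
  move=> Et0; have {Et0} : q Phi t <= 1 / (14 ^+ d.+2 * lam ^+ d.+1) := Et0.
  rewrite /Phi qval_gate /=; set p := pval _ _ _ _; set k := kval _ _ _ _ => Et.
  have p0 : 0 < p by exact: pval_gt0.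
  have k0 : 0 < k%:R :> R by rewrite ltr0n; exact: kval_ge1.
  have uk : U * p * lam <= k%:R.
    move: Et; rewrite ler_pdivrMr ?mulr_gt0 // [in X in _ <= X]exprS [lam ^+ d.+1]exprS.
    have -> : 1 / (14 * 14 ^+ d.+1 * (lam * lam ^+ d)) * (14 * k%:R) = k%:R / (U * lam).
      by rewrite /U; field; rewrite !gt_eqF ?exprn_gt0.
    have -> : U * p * lam = p * (U * lam) by ring.
    by rewrite ler_pdivlMr // mulr_gt0.
  have [up|up] := leP (U * p) (expR (-1)).
    have [F FP pF] := pval_ex (sigma t) (tau t) Psi Psis.
    rewrite -/p in pF; exists F.
      rewrite mem_filter FP andbT; case: F pF {FP} => //= i b p1.
      move: up; rewrite p1 mulr1 leNgt => /negP; case.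
      by apply: lt_le_trans U1; rewrite expR_lt1; lra.
    by left; rewrite /small_event /= -pF /x ler_pdivlMr // mulrC.
  have up1 : U * p <= U.
    have [F FP pF] := pval_ex (sigma t) (tau t) Psi Psis.
    by rewrite -[leRHS]mulr1 ler_pM2l // /p pF qval_le1.
  have exi : exists i : nat, U * p < expR i%:R by exists N0; apply: le_lt_trans UN0.
  case: (ex_minnP exi) => i ui imin.
  have iN : (i < N)%N by rewrite ltnS; apply: imin; apply: le_lt_trans UN0.
  have iu : expR (i%:R - 1) <= U * p.
    case: i ui imin {iN} => [|i] _ imin; first by rewrite sub0r ltW.
    rewrite -natr1 addrK leNgt; by apply/negP => /imin; rewrite ltnn.
  have lamk : lam * expR (i%:R - 1) <= k%:R.
    by apply: le_trans uk; rewrite mulrC ler_pM2r.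
  have k1 : (1 < k)%N.
    rewrite -(ltr_nat R); apply: lt_le_trans uk.
    have -> : 1 = expR (-1) * expR 1 :> R by rewrite mulrC expRxMexpNx_1.
    by apply: ltr_pM; rewrite ?expR_ge0.
  have [F FP FD] := kval_ex k1; rewrite -/k in FD.
  have Fs : F \in s.
    rewrite mem_filter FP andbT; case: F FD {FP} => // i' b FD.
    by move: k1; rewrite -FD ltnNge Ddepth_literal.
  have pF : p <= q F t by exact: pval_le.
  have deeper r : p <= r -> (M i <= D F t r)%N.
    move=> pr; apply: leq_trans ((MP i).2 k lamk) _; rewrite -FD.
    by apply: Ddepth_restrict_le => i' b; exact: Rst_le.
  exists F => //; right; rewrite -bigcup_seq; exists (Ordinal iN).
    by rewrite /= mem_index_enum.
  rewrite /Ei /=; have [uF|uF] := leP (U * q F t) (expR i%:R).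
    left; rewrite /deep_event /= oppr0 expR0 mul1r; apply/andP; split.
      by rewrite /x ler_pdivlMr // mulrC.
    exact: deeper.
  right; have qU : U * q F t <= U by rewrite -[leRHS]mulr1 ler_pM2l // qval_le1.
  have UN j : (N0 <= j)%N -> U * q F t <= expR j%:R.
    move=> N0j; apply: le_trans qU _; apply: le_trans (ltW UN0) _.
    by rewrite ler_expR ler_nat.
  have exj : exists j : nat, U * q F t <= expR (i + j + 1)%N%:R.
    by exists N0; apply: UN; rewrite addn1 leqW // leq_addl.
  case: (ex_minnP exj) => j uj jmin.
  have jN : (j < N)%N by rewrite ltnS; apply: jmin; apply: UN; rewrite addn1 leqW // leq_addl.
  have ju : expR (i + j)%N%:R <= U * q F t.
    case: j uj jmin {jN} => [|j] _ jmin; first by rewrite addn0 ltW.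
    by rewrite leNgt; apply/negP => /ltW; rewrite -addn1 addnA => /jmin; rewrite ltnn.
  rewrite -bigcup_seq; exists (Ordinal jN); first by rewrite /= mem_index_enum.
  rewrite /deep_event /=; apply/andP; split.
    by rewrite /x ler_pdivlMr // mulrC.
  apply: deeper; rewrite -(ler_pM2l U0) mulrCA; apply: le_trans (ltW ui) _.
  have -> : expR i%:R = expR (- j%:R) * expR (i + j)%N%:R :> R.
    by rewrite -expRD natrD; congr expR; ring.
  by rewrite ler_pM2l ?expR_gt0.
apply: le_trans (prob_subset_union mE mEF PE cover) _.
rewrite lee_fin -/B -mulr_suml -mulr_suml exprSr !mulrA; apply: ler_wpM2r; first exact: expR_ge0.
apply: ler_wpM2r => //; apply: ler_wpM2r; first exact: exprn_ge0.
rewrite -natr_sum ler_nat; apply: leq_trans (size_children g Psi Psis).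
by rewrite big_filter big_mkcond; apply: leq_sum => F _; case: ifP.
Qed.

Lemma scale_boundP d : scale_bound d.
Proof.
elim: d => [|d IH]; first exact: scale_bound0.
move=> F lam m Fg Fd lam0; pose lam' := lam * expR (- (m / d.+1%:R)).
have lam'0 : 0 < lam' by rewrite mulr_gt0 ?expR_gt0.
have := scale_bound_step IH Fg Fd lam'0.
have -> : 1 / (14 ^+ d.+2 * lam' ^+ d.+1) = expR m / (14 ^+ d.+2 * lam ^+ d.+1).
  rewrite /lam' exprMn -expRM_natr mulNr divfK // expRN; field.
  by rewrite !gt_eqF ?expR_gt0 ?exprn_gt0.
move=> /le_trans; apply; rewrite lee_fin; apply: ler_wpM2l.
  by rewrite mulr_ge0 // exprn_ge0.
rewrite ler_expR lerN2 -!mulrA ler_pM2l ?expR_gt0 // ler_pM2l //.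
have -> : d.+1%:R - m = (1 + - (m / d.+1%:R)) * d.+1%:R by field.
by rewrite ler_pM2r // expR_ge1Dx.
Qed.

Lemma small_event_le d F (l : R) : is_gate F -> depth_formula F = d.+2 -> 0 < l ->
  (P (small_event F (1 / (14 ^+ d.+2 * l))) <=
   ((size_formula F)%:R *
    (C ^+ d.+1 / expR (expR (- 2) * d.+1%:R * l `^ (1 / d.+1%:R))))%:E)%E.
Proof.
move=> Fg Fd l0; have lam0 : 0 < l `^ (1 / d.+1%:R) by rewrite powR_gt0.
have := scale_bound_step (scale_boundP (d := d)) Fg _ lam0.
have -> : (l `^ (1 / d.+1%:R)) ^+ d.+1 = l.
  by rewrite -powR_mulrn ?powR_ge0 // -powRrM div1r mulVf // powRr1 // ltW.
by rewrite Fd leqnn expRN -mulrA [X in expR X]mulrAC => /(_ isT).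
Qed.

End tail_bound.

(** * The constant [C] *)

Section exponential_bounds.
Context (R : realType).
Implicit Types (x z : R).

Fixpoint exp_nest x (j m : nat) z : R :=
  if m is m'.+1 then 1 + x / j.+1%:R * exp_nest x j.+1 m' z else z.

Lemma exp_coeffS x k : exp_coeff x k.+1 = x / k.+1%:R * exp_coeff x k.
Proof.
rewrite /exp_coeff /= exprS factS natrM invfM !mulrA; congr (_ * _).
by rewrite mulrAC.
Qed.

Lemma exp_nestE x j m z :
  exp_nest x j m z * exp_coeff x j =
  \sum_(j <= k < j + m) exp_coeff x k + z * exp_coeff x (j + m)%N.
Proof.
elim: m j => [|m IH] j; first by rewrite !addn0 big_geq // add0r.
rewrite /= mulrDl mul1r mulrAC -exp_coeffS mulrC IH addSnnS addrA; congr (_ + _).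
by rewrite [RHS]big_ltn // addnS ltnS leq_addr.
Qed.

Lemma exp_nest_series x m z :
  exp_nest x 0 m z = series (exp_coeff x) m + z * exp_coeff x m.
Proof.
have := exp_nestE x 0 m z; rewrite add0n => <-.
by rewrite /exp_coeff /= expr0 fact0 invr1 !mulr1.
Qed.

Let exp_coeff_ge0 x k : 0 <= x -> 0 <= exp_coeff x k.
Proof. by move=> x0; rewrite /exp_coeff /= divr_ge0 ?exprn_ge0. Qed.

Let series_exp_nd x : 0 <= x -> nondecreasing_seq (series (exp_coeff x)).
Proof. by move=> x0; apply: nondecreasing_series => k _ _; exact: exp_coeff_ge0. Qed.

Lemma expR_ge_nest x m : 0 <= x -> exp_nest x 0 m 1 <= expR x.
Proof.
move=> x0; rewrite exp_nest_series mul1r -seriesSr.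
apply: nondecreasing_cvgn_le; [exact: series_exp_nd|exact: is_cvg_series_exp_coeff].
Qed.

Lemma expR_le_nest x m : 0 <= x <= 1 -> expR x <= exp_nest x 0 m.+1 2.
Proof.
move=> /andP[x0 x1].
have step k : exp_nest x 0 k.+2 2 <= exp_nest x 0 k.+1 2.
  rewrite !exp_nest_series [series _ k.+2]seriesSr -addrA lerD2l [exp_coeff x k.+2]exp_coeffS.
  set c := exp_coeff x k.+1; have c0 : 0 <= c by exact: exp_coeff_ge0.
  have : x / k.+2%:R <= 1 / 2.
    rewrite ler_pdivrMr //; apply: le_trans x1 _.
    by rewrite mul1r ler_pdivlMl // mulr1 ler_nat.
  by move: (x / _) => y; nra.
have mono i : exp_nest x 0 (m.+1 + i) 2 <= exp_nest x 0 m.+1 2.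
  elim: i => [|i IH]; first by rewrite addn0.
  by apply: le_trans IH; rewrite addnS; exact: step.
apply: limr_le; first exact: is_cvg_series_exp_coeff.
near=> N; apply: le_trans (mono (N - m.+1)%N).
rewrite subnKC; last by near: N; exists m.+1.
by rewrite exp_nest_series lerDl mulr_ge0 // exp_coeff_ge0.
Unshelve. all: by end_near. Qed.

End exponential_bounds.

Section constant.
Context (R : realType).

Definition tail_ratio (i : nat) : R := expR (- (expR (i%:R - 1) - expR (- 2))).
Definition tail_beta : R := expR (expR (- 2)).
Definition tail_sum (r b : R) (i : nat) : R := r * b ^+ i * (1 + b / (1 - r)).
Definition tail_level (i : nat) : R := tail_sum (tail_ratio i) tail_beta i.

Lemma tail_ratio_lt1 i : 0 < tail_ratio i < 1.
Proof.
rewrite expR_gt0 expR_lt1 oppr_lt0 subr_gt0 ltr_expR /=.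
by have : 0 <= i%:R :> R by []; lra.
Qed.

Lemma tail_beta_gt0 : 0 < tail_beta. Proof. exact: expR_gt0. Qed.

Lemma tail_term0E i : tail_term0 R i = tail_ratio i * tail_beta ^+ i.
Proof.
rewrite /tail_term0 -expRN -expRM_natl -expRD; congr expR.
by rewrite -natr1; ring.
Qed.

Lemma tail_termE i :
  tail_term R i = geometric (tail_ratio i * tail_beta ^+ i.+1) (tail_ratio i).
Proof.
apply/funext => j /=; rewrite /tail_term -expRN -!expRM_natl -!expRD; congr expR.
have -> : (i + j + 2)%N%:R = i%:R + j%:R + 2 :> R by rewrite !natrD.
by rewrite -!natr1; ring.
Qed.

Lemma cvg_tail_term i :
  series (tail_term R i) @ \oo --> tail_ratio i * tail_beta ^+ i.+1 / (1 - tail_ratio i).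
Proof.
rewrite tail_termE; apply: cvg_geometric_series.
by have /andP[r0 r1] := tail_ratio_lt1 i; rewrite gtr0_norm.
Qed.

Lemma tail_levelE i : tail_level i = tail_term0 R i + limn (series (tail_term R i)).
Proof.
rewrite (cvg_lim _ (@cvg_tail_term i)) // tail_term0E /tail_level /tail_sum exprSr.
by rewrite mulrDr mulr1 !mulrA.
Qed.

Lemma CconstE : Cconst R = 1 + limn (series tail_level).
Proof.
by rewrite (_ : tail_level = fun i => tail_term0 R i + limn (series (tail_term R i)));
   last by apply/funext => i; exact: tail_levelE.
Qed.

Lemma tail_level_ge0 i : 0 <= tail_level i.
Proof.
have /andP[r0 r1] := tail_ratio_lt1 i.
have b0 := tail_beta_gt0; rewrite /tail_level /tail_sum.
apply: mulr_ge0; first by rewrite mulr_ge0 ?exprn_ge0 // ltW.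
by rewrite addr_ge0 // divr_ge0 ?subr_ge0 // ltW.
Qed.

Lemma tail_sum_le (r r' b b' : R) i : 0 <= r <= r' -> r' < 1 -> 0 <= b <= b' ->
  tail_sum r b i <= tail_sum r' b' i.
Proof.
move=> /andP[r0 rr'] r'1 /andP[b0 bb'].
have r1 : 0 < 1 - r by lra.
have r'0 : 0 < 1 - r' by lra.
rewrite /tail_sum; apply: ler_pM.
- by rewrite mulr_ge0 ?exprn_ge0.
- by rewrite addr_ge0 // divr_ge0 // ltW.
- apply: ler_pM => //; first exact: exprn_ge0.
  by apply: lerXn2r; rewrite ?nnegrE //; lra.
rewrite lerD2l; apply: ler_pM => //; first by rewrite invr_ge0 ltW.
by rewrite lef_pV2 ?posrE //; lra.
Qed.

(* [Cconst R] is about 7.82577, barely above 7.825, so the chain of rational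
   enclosures below is accurate to about 1e-5. *)
Lemma expR1_bounds : 1264 / 465 <= (expR 1 : R) <= 1650 / 607.
Proof.
apply/andP; split.
  by apply: (le_trans _ (@expR_ge_nest R 1 9 _)); cbn [exp_nest]; clear; lra.
by apply: (le_trans (@expR_le_nest R 1 8 _)); cbn [exp_nest]; clear; lra.
Qed.

Lemma expR_nat_bounds (l u : R) m : 0 <= l -> l <= expR 1 <= u ->
  l ^+ m <= expR m%:R <= u ^+ m.
Proof.
move=> l0 /andP[El Eu]; rewrite -[m%:R]mulr1 expRM_natl.
have u0 : 0 <= u by apply: le_trans Eu; exact: expR_ge0.
by rewrite !lerXn2r // nnegrE expR_ge0.
Qed.

Lemma mul_bounds (a al au b bl bu : R) : 0 <= al -> 0 <= bl ->
  al <= a <= au -> bl <= b <= bu -> al * bl <= a * b <= au * bu.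
Proof.
move=> al0 bl0 /andP[al_le au_ge] /andP[bl_le bu_ge].
have a0 : 0 <= a by apply: le_trans al_le.
have b0 : 0 <= b by apply: le_trans bl_le.
by rewrite !ler_pM.
Qed.

Let low_ge0 : 0 <= 1264 / 465 :> R.
Proof. by apply: divr_ge0; exact: ler0n. Qed.

Lemma expRN1_bounds : 71 / 193 <= (expR (-1) : R) <= 323 / 878.
Proof.
have := expRxMexpNx_1 (1 : R); have := expR1_bounds; have := expR_gt0 (-1 : R).
by move: (expR 1) (expR (-1)) => E a; nra.
Qed.

Lemma expRN2_bounds : 131 / 968 <= (expR (-2) : R) <= 18 / 133.
Proof.
have -> : -2 = -1 + -1 :> R by lra.
by rewrite expRD; have := expRN1_bounds; move: (expR (-1)) => a; nra.
Qed.

Lemma tail_beta_bounds : 1114 / 973 <= tail_beta <= 79 / 69.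
Proof.
have /andP[bl bu] := expRN2_bounds; apply/andP; split.
  apply: (@le_trans _ _ (expR (131 / 968))); last by rewrite ler_expR.
  by apply: (le_trans _ (@expR_ge_nest R _ 5 _)); cbn [exp_nest]; clear; lra.
apply: (@le_trans _ _ (expR (18 / 133))); first by rewrite ler_expR.
by apply: (le_trans (@expR_le_nest R _ 5 _)); cbn [exp_nest]; clear; lra.
Qed.

Lemma tail_ratio0_bounds : 592 / 747 <= tail_ratio 0 <= 424 / 535.
Proof.
have := expRN1_bounds; have := expRN2_bounds; rewrite /tail_ratio sub0r.
move: (expR (-1)) (expR (-2)) => a b /andP[bl bu] /andP[al au].
have el : 535 / 424 <= expR (a - b).
  apply: (@le_trans _ _ (expR (223 / 959))); last by rewrite ler_expR; lra.
  by apply: (le_trans _ (@expR_ge_nest R _ 6 _)); cbn [exp_nest]; clear; lra.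
have eu : expR (a - b) <= 747 / 592.
  apply: (@le_trans _ _ (expR (10 / 43))); first by rewrite ler_expR; lra.
  by apply: (le_trans (@expR_le_nest R _ 5 _)); cbn [exp_nest]; clear; lra.
have := expRxMexpNx_1 (a - b); have := expR_gt0 (- (a - b)).
by move: el eu; move: (expR (a - b)) (expR _) => x y; nra.
Qed.

Lemma tail_ratio1_bounds : 334 / 793 <= tail_ratio 1 <= 302 / 717.
Proof.
rewrite /tail_ratio subrr expR0 opprB addrC expRD -/tail_beta.
have := expRN1_bounds; have := tail_beta_bounds.
by move: tail_beta (expR (-1)) => b a; nra.
Qed.

Lemma div_bounds (b bl bu x xl xu : R) : 0 < xl -> bl <= b <= bu -> xl <= x <= xu ->
  0 <= bl -> bl / xu <= b / x <= bu / xl.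
Proof.
move=> xl0 /andP[bl_le bu_ge] /andP[xl_le xu_ge] bl0.
have x0 : 0 < x by apply: lt_le_trans xl_le.
have xu0 : 0 < xu by apply: lt_le_trans xu_ge.
apply: mul_bounds => //; first by rewrite invr_ge0 ltW.
  by rewrite bl_le bu_ge.
by rewrite !lef_pV2 ?posrE ?xu_ge.
Qed.

Lemma tail_ratio2_bounds : 55 / 728 <= tail_ratio 2 <= 17 / 225.
Proof.
rewrite /tail_ratio (_ : 2 - 1 = 1 :> R); last lra.
rewrite opprB expRB -/tail_beta.
have X : (1264 / 465) ^+ 2 * (1934 / 943) <= (expR (expR 1) : R) <=
    (1650 / 607) ^+ 2 * (1450 / 707).
  have -> : expR (expR 1) = expR 2 * expR (expR 1 - 2) :> R.
    by rewrite -expRD; congr expR; ring.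
  apply: mul_bounds; [exact: exprn_ge0|by apply: divr_ge0; exact: ler0n| |].
    exact: expR_nat_bounds expR1_bounds.
  have /andP[El Eu] := expR1_bounds; apply/andP; split.
    apply: (@le_trans _ _ (expR (1264 / 465 - 2))); last by rewrite ler_expR lerD2r.
    by apply: (le_trans _ (@expR_ge_nest R _ 8 _)); cbn [exp_nest]; clear; lra.
  apply: (@le_trans _ _ (expR (1650 / 607 - 2))); first by rewrite ler_expR lerD2r.
  by apply: (le_trans (@expR_le_nest R _ 7 _)); cbn [exp_nest]; clear; lra.
have [||rl ru] := andP (div_bounds _ tail_beta_bounds X _).
- by clear; lra.
- by apply: divr_ge0; exact: ler0n.
apply/andP; split.
  by apply: (le_trans _ rl); clear; lra.
by apply: (le_trans ru); clear; lra.
Qed.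

Lemma tail_ratio3_bounds : 1 / 1500 <= tail_ratio 3 <= 1 / 1000.
Proof.
rewrite /tail_ratio (_ : 3 - 1 = 2 :> R); last lra.
rewrite opprB expRB -/tail_beta.
have X : (1264 / 465) ^+ 7 * (146 / 100) <= (expR (expR 2) : R) <= (1650 / 607) ^+ 7 * (148 / 100).
  have -> : expR (expR 2) = expR 7 * expR (expR 2 - 7) :> R.
    by rewrite -expRD; congr expR; ring.
  apply: mul_bounds; [exact: exprn_ge0|by apply: divr_ge0; exact: ler0n| |].
    exact: expR_nat_bounds expR1_bounds.
  have E2 := expR_nat_bounds 2 low_ge0 expR1_bounds; apply/andP; split.
    apply: (@le_trans _ _ (expR (38 / 100))); last first.
      by rewrite ler_expR; move: E2; move: (expR 2) => x; clear; lra.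
    by apply: (le_trans _ (@expR_ge_nest R _ 5 _)); cbn [exp_nest]; clear; lra.
  apply: (@le_trans _ _ (expR (39 / 100))).
    by rewrite ler_expR; move: E2; move: (expR 2) => x; clear; lra.
  by apply: (le_trans (@expR_le_nest R _ 5 _)); cbn [exp_nest]; clear; lra.
have [||rl ru] := andP (div_bounds _ tail_beta_bounds X _).
- by clear; lra.
- by apply: divr_ge0; exact: ler0n.
apply/andP; split.
  by apply: (le_trans _ rl); clear; lra.
by apply: (le_trans ru); clear; lra.
Qed.

Lemma tail_sum_eval (r b s : R) i : r < 1 -> (1 - r) * s = b ->
  tail_sum r b i = r * b ^+ i * (1 + s).
Proof.
move=> r1 <-; rewrite /tail_sum [(1 - r) * s]mulrC mulfK // gt_eqF //.
by rewrite subr_gt0.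
Qed.

Lemma tail_level_bounds i (bl bu rl ru sl su lo hi : R) :
  0 <= bl -> bl <= tail_beta <= bu ->
  0 <= rl -> rl <= tail_ratio i <= ru -> ru < 1 ->
  (1 - rl) * sl = bl -> (1 - ru) * su = bu ->
  lo <= rl * bl ^+ i * (1 + sl) -> ru * bu ^+ i * (1 + su) <= hi ->
  lo <= tail_level i <= hi.
Proof.
move=> bl0 /andP[bl_le bu_ge] rl0 /andP[rl_le ru_ge] ru1 slE suE lo_le hi_ge.
have /andP[r0 r1] := tail_ratio_lt1 i.
apply/andP; split.
  apply: (le_trans lo_le); rewrite -(tail_sum_eval _ _ slE); last lra.
  by apply: tail_sum_le; rewrite ?rl0 ?bl0 ?rl_le ?bl_le.
apply: (le_trans _ hi_ge); rewrite -(tail_sum_eval _ _ suE); last lra.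
by apply: tail_sum_le; rewrite ?ru_ge ?bu_ge ?andbT // ltW // tail_beta_gt0.
Qed.

Lemma tail_level0_bounds : 5 + 1653 / (100 * 100) <= tail_level 0 <= 5 + 166 / 1000.
Proof.
apply: (tail_level_bounds (sl := 1114 / 973 * (747 / 155)) (su := 79 / 69 * (535 / 111))
  _ tail_beta_bounds _ tail_ratio0_bounds); clear; lra.
Qed.

Lemma tail_level1_bounds : 1 + 436 / 1000 <= tail_level 1 <= 1 + 437 / 1000.
Proof.
apply: (tail_level_bounds (sl := 1114 / 973 * (793 / 459)) (su := 79 / 69 * (717 / 415))
  _ tail_beta_bounds _ tail_ratio1_bounds); clear; lra.
Qed.

Lemma tail_level2_bounds : 2216 / (100 * 100) <= tail_level 2 <= 222 / 1000.
Proof.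
apply: (tail_level_bounds (sl := 1114 / 973 * (728 / 673)) (su := 79 / 69 * (225 / 208))
  _ tail_beta_bounds _ tail_ratio2_bounds); clear; lra.
Qed.

Lemma tail_level3_bounds : 21 / (100 * 100) <= tail_level 3 <= 4 / 1000.
Proof.
apply: (tail_level_bounds (sl := 1114 / 973 * (1500 / 1499))
  (su := 79 / 69 * (1000 / 999)) _ tail_beta_bounds _ tail_ratio3_bounds); clear; lra.
Qed.

Lemma tail_level_small i : (4 <= i)%N -> tail_level i <= (1 / 2) ^+ i / 100.
Proof.
move=> i4; have /andP[r0 r1] := tail_ratio_lt1 i; have /andP[bl bu] := tail_beta_bounds.
have i4R : 4 <= i%:R :> R by rewrite ler_nat.
have /andP[El _] := expR1_bounds.
have ai : i%:R + 8 <= expR (i%:R - 1) :> R.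
  have -> : i%:R - 1 = 3 * 1 + (i%:R - 4) :> R by lra.
  rewrite expRD mulr1.
  have /andP[+ _] := expR_nat_bounds 3 low_ge0 expR1_bounds.
  have := expR_ge1Dx (i%:R - 4 : R); move: (expR 3) (expR _) i4R => E3 x; clear; nra.
have e8 : expR (- 8) <= 1 / 1000 :> R.
  have /andP[+ _] := expR_nat_bounds 8 low_ge0 expR1_bounds; rewrite expRN; move: (expR 8) => x xl.
  by rewrite -div1r ler_pdivrMr; move: xl; clear; lra.
have ri : tail_ratio i <= tail_beta * (expR (- 8) * expR (- i%:R)).
  by rewrite /tail_ratio -!expRD ler_expR; lra.
have ei : expR (- i%:R) * (2 * tail_beta) ^+ i <= 1 :> R.
  rewrite expRN mulrC ler_pdivrMr ?expR_gt0 // mul1r -[X in expR X]mulr1 expRM_natl.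
  by apply: lerXn2r; rewrite ?nnegrE ?expR_ge0 //; lra.
have ri2 : tail_ratio i <= 1 / 100.
  apply: (le_trans ri); have : expR (- i%:R) <= 1 :> R by rewrite expR_le1; lra.
  have := expR_gt0 (- 8 : R); have := expR_gt0 (- i%:R : R).
  move: bu bl e8; move: (expR (- i%:R : R)) (expR (- 8 : R)) tail_beta => y x b; clear.
  move=> bu bl x1 y0 x0 y1.
  suff : b * (x * y) <= 2 * x by lra.
  by apply: ler_pM; [lra|apply: mulr_ge0; exact: ltW|lra|rewrite ler_piMr // ltW].
apply: (@le_trans _ _ (tail_ratio i * tail_beta ^+ i * 3)).
  rewrite /tail_level /tail_sum; apply: ler_wpM2l.
    by rewrite mulr_ge0 ?exprn_ge0 //; lra.
  have : tail_beta / (1 - tail_ratio i) <= 2 by rewrite ler_pdivrMr; lra.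
  by lra.
have -> : (1 / 2) ^+ i / 100 = (2 ^+ i)^-1 / 100 :> R by rewrite div1r exprVn.
rewrite mulrAC ler_pdivlMl ?exprn_gt0 //.
have -> : 2 ^+ i * (tail_ratio i * 3 * tail_beta ^+ i) =
    3 * tail_ratio i * (2 * tail_beta) ^+ i by rewrite exprMn; ring.
have B0 : 0 <= (2 * tail_beta) ^+ i by apply: exprn_ge0; lra.
apply: (@le_trans _ _ (3 * (tail_beta * (expR (- 8) * expR (- i%:R))) * (2 * tail_beta) ^+ i)).
  by apply: ler_wpM2r => //; apply: ler_wpM2l.
have := expR_gt0 (- 8 : R); move: ei bu bl e8 B0; clear.
move: ((2 * tail_beta) ^+ i) (expR (- i%:R : R)) (expR (- 8 : R)) tail_beta => B y x b.
rewrite -!mulrA.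
move=> yB bu bl x1 B0 x0.
apply: (@le_trans _ _ (3 * (b * (x * 1)))); last nra.
by do 3!(apply: ler_wpM2l; first lra).
Qed.

Lemma series_tail_level_nd : nondecreasing_seq (series tail_level).
Proof. by apply: nondecreasing_series => i _ _; exact: tail_level_ge0. Qed.

Lemma series_tail_level4 :
  6825 / 1000 <= series tail_level 4%N <= 6829 / 1000.
Proof.
rewrite /series /= !big_nat_recr //= big_geq // add0r.
have := tail_level0_bounds; have := tail_level1_bounds.
have := tail_level2_bounds; have := tail_level3_bounds.
move: (tail_level 0) (tail_level 1) (tail_level 2) (tail_level 3) => a b c d; clear; lra.
Qed.

Lemma series_tail_level_le N : series tail_level N <= 6835 / 1000.
Proof.
have /andP[_ S4] := series_tail_level4.
have bound (i : nat) : series tail_level (4 + i)%N <=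
    6829 / 1000 + (1 / 8 - 2 * (1 / 2) ^+ (4 + i)) / 100.
  elim: i => [|i IH]; first by rewrite addn0; lra.
  rewrite addnS seriesSr; have := @tail_level_small (4 + i)%N (leq_addr _ _).
  move: IH; rewrite [_ ^+ _.+1]exprS.
  by move: (_ ^+ _) (series _ _) (tail_level _) => x y z; clear; lra.
have [N4|/ltnW N4] := leqP 4 N.
  have := bound (N - 4)%N; rewrite (subnKC N4).
  have : 0 <= (1 / 2) ^+ N :> R by apply: exprn_ge0; lra.
  by move: (_ ^+ _) (series _ _) => x y; clear; lra.
by apply: le_trans (series_tail_level_nd N4) _; lra.
Qed.

Lemma cvg_series_tail_level : cvgn (series tail_level).
Proof.
apply: nondecreasing_is_cvgn; first exact: series_tail_level_nd.
by exists (6835 / 1000) => _ [N _ <-]; exact: series_tail_level_le.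
Qed.

Lemma Cconst_bounds : 7825 / 1000 <= Cconst R <= 7835 / 1000.
Proof.
rewrite CconstE; have /andP[S4 _] := series_tail_level4.
have := nondecreasing_cvgn_le series_tail_level_nd cvg_series_tail_level 4%N.
have : limn (series tail_level) <= 6835 / 1000.
  apply: limr_le; first exact: cvg_series_tail_level.
  by apply: nearW => N; exact: series_tail_level_le.
by move: S4; move: (limn _) (series _ _) => x y; clear; lra.
Qed.

Lemma Cconst_partial N :
  1 + \sum_(i < N) (tail_term0 R i + \sum_(j < N) tail_term R i j) <= Cconst R.
Proof.
rewrite CconstE lerD2l.
apply: le_trans (nondecreasing_cvgn_le series_tail_level_nd cvg_series_tail_level N).
rewrite /series /= big_mkord; apply: ler_sum => i _; rewrite tail_levelE lerD2l.
have nd : nondecreasing_seq (series (tail_term R i)).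
  by apply: nondecreasing_series => j _ _; rewrite /tail_term invr_ge0 expR_ge0.
have cv : cvgn (series (tail_term R i)) by apply/cvg_ex; eexists; exact: cvg_tail_term.
by have := nondecreasing_cvgn_le nd cv N; rewrite /series /= big_mkord.
Qed.

End constant.

Theorem theorem10 (R : realType) :
  [/\ `|Cconst R - 783 / 100| <= 1 / 200,
      forall (d n : nat) (Phi : formula n) (l : R)
             (disp : measure_display) (T : measurableType disp)
             (P : probability T R)
             (sigma : {RV P >-> n.-tuple bool}) (tau : {RV P >-> n.-tuple R}),
        (1 <= d)%N -> depth_formula Phi = d.+1 -> 0 < l ->
        uniform_bits sigma -> uniform_cube tau -> independent_RV2 sigma tau ->
        (P [set w | (qval (sigma w) (tau w) Phi <= 1 / (14 ^+ d.+1 * l))%R] <=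
         ((size_formula Phi)%:R *
          (Cconst R ^+ d / expR (expR (- 2) * d%:R * l `^ (1 / d%:R))))%:E)%E
    & exists c K : R, [/\ 0 < c, 0 < K &
      forall (d n : nat) (Phi : formula n) (lambda : R)
             (disp : measure_display) (T : measurableType disp)
             (P : probability T R)
             (sigma : {RV P >-> n.-tuple bool}) (tau : {RV P >-> n.-tuple R}),
        (1 <= d)%N -> depth_formula Phi = d.+1 -> 0 < lambda <= 1 ->
        uniform_bits sigma -> uniform_cube tau -> independent_RV2 sigma tau ->
        (P [set w | (qval (sigma w) (tau w) Phi <= lambda)%R] <=
         ((size_formula Phi)%:R /
          expR (c * (d%:R * lambda `^ (- (1 / d%:R))) - K * d%:R))%:E)%E]].
Proof.
have C_bounds := Cconst_bounds R.
have C_gt0 : 0 < Cconst R by move: C_bounds; move: (Cconst R) => x; clear; lra.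
have C_expR1 : expR 1 <= Cconst R.
  move: C_bounds (expR1_bounds R); move: (Cconst R) (expR 1) => x e; clear; lra.
have tail (d n : nat) (Phi : formula n) (l : R)
    (disp : measure_display) (T : measurableType disp) (P : probability T R)
    (sigma : {RV P >-> n.-tuple bool}) (tau : {RV P >-> n.-tuple R}) :
    (1 <= d)%N -> depth_formula Phi = d.+1 -> 0 < l ->
    uniform_bits sigma -> uniform_cube tau -> independent_RV2 sigma tau ->
    (P [set w | (qval (sigma w) (tau w) Phi <= 1 / (14 ^+ d.+1 * l))%R] <=
     ((size_formula Phi)%:R *
      (Cconst R ^+ d / expR (expR (- 2) * d%:R * l `^ (1 / d%:R))))%:E)%E.
  case: d => // d _ Phid l0 us ut ind.
  apply: (small_event_le (@Cconst_partial R) C_expR1 us ut ind) => //.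
  by case: Phi Phid.
split => //.
  by rewrite ler_norml; move: C_bounds; move: (Cconst R) => x; clear; lra.
exists (expR (- 2) / 196), (Cconst R); split => //.
move=> d n Phi lambda disp T P sigma tau d1 Phid /andP[lam0 lam1] us ut ind.
have d0 : 0 < d%:R :> R by rewrite ltr0n.
set l : R := (14 ^+ d.+1 * lambda)^-1.
have l0 : 0 < l by rewrite invr_gt0 mulr_gt0 // exprn_gt0.
have lamE : lambda = 1 / (14 ^+ d.+1 * l).
  by rewrite /l [(_ * lambda)^-1]invfM mulVKf ?div1r ?invrK // expf_neq0.
have := tail d n Phi l disp T P sigma tau d1 Phid l0 us ut ind.
rewrite -lamE => /le_trans; apply; rewrite lee_fin; apply: ler_wpM2l => //.
rewrite -expRN; apply: (@le_trans _ _ (expR (Cconst R * d%:R) *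
  expR (- (expR (- 2) * d%:R * l `^ (1 / d%:R))))).
  rewrite expRN; apply: ler_wpM2r; first by rewrite invr_ge0 expR_ge0.
  rewrite expRM_natr; apply: lerXn2r; rewrite ?nnegrE ?expR_ge0 //; first exact: ltW.
  by apply: le_trans (expR_ge1Dx _); rewrite lerDr.
rewrite -[leRHS]expRN -expRD ler_expR opprB lerD2l lerN2.
have -> : expR (- 2) / 196 * (d%:R * lambda `^ (- (1 / d%:R))) =
    expR (- 2) * d%:R * (lambda `^ (- (1 / d%:R)) / 196) by ring.
apply: ler_wpM2l; first by rewrite mulr_ge0 ?expR_ge0.
have -> : l `^ (1 / d%:R) = (14 ^+ d.+1) `^ (- (1 / d%:R)) * lambda `^ (- (1 / d%:R)).
  rewrite -powRM ?exprn_ge0 //; last exact: ltW.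
  rewrite /l -(@powR_inv1 _ (14 ^+ d.+1 * lambda)) -?powRrM ?mulN1r //.
  by rewrite mulr_ge0 ?exprn_ge0 // ltW.
rewrite mulrC; apply: ler_wpM2r; first exact: powR_ge0.
rewrite powRN lef_pV2 ?posrE ?powR_gt0 ?exprn_gt0 // -powR_mulrn // -powRrM.
apply: (@le_trans _ _ (14 `^ 2%:R)); last by rewrite powR_mulrn //; lra.
apply: ler_powR; first lra.
rewrite mulrA mulr1 ler_pdivrMr // -natrM ler_nat.
by rewrite mul2n -addnn -[X in (X < _)%N]addn0 ltn_add2l.
Qed.
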